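(* If $\nu>-1$, then the functions $\mathbf{\Phi}_\nu$ and $\mathbf{\Pi}_\nu$ have infinitely many zeros, which are all real.
   Context: $J_\nu$ and $I_\nu$ denote the Bessel and modified Bessel functions of the first kind, and $$\mathbf{\Phi}_\nu(z)=J_\nu(z)I_\nu'(z)-J_\nu'(z)I_\nu(z)=2\sum_{n\ge 0}\frac{(-1)^n (z/2)^{2\nu+4n+1}}{n!\,\Gamma(\nu+n+1)\Gamma(\nu+2n+2)},$$ $$\mathbf{\Pi}_\nu(z)=J_\nu(z)I_\nu(z)=\sum_{n\ge 0}\frac{(-1)^n (z/2)^{2\nu+4n}}{n!\,\Gamma(\nu+n+1)\Gamma(\nu+2n+1)}.$$
   Formalization: ''All real'' fails literally: z→iz maps zeros to zeros, so real zeros yield imaginary ones. Proved instead: infinitely many positive zeros, and each zero off the cut (-∞,0] is i^k x with x a positive zero; zeros off the imaginary axis are real. *)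

(* Defs.v *)
From Stdlib Require Import Reals List Factorial.
From Coquelicot Require Import Coquelicot.

Open Scope R_scope.

(* Euler's integral; meaningful for [0 < x], the only case used below
   (the arguments are [nu + n + 1] with [-1 < nu]). *)
Definition Gamma (x : R) : R :=
  RInt_gen (fun t => Rpower t (x - 1) * exp (- t))
           (at_right 0) (Rbar_locally p_infty).

Definition slit_plane (z : C) : Prop := ~ (Re z <= 0 /\ Im z = 0).

(* Principal argument, with values in (-PI, PI), on the slit plane: the
   half-angle formula  tan (arg z / 2) = Im z / (|z| + Re z). *)
Definition Carg (z : C) : R := 2 * atan (Im z / (Cmod z + Re z)).

(* Principal branch of [z ^ mu], real exponent, on the slit plane. *)
Definition CRpower (z : C) (mu : R) : C :=
  (RtoC (Rpower (Cmod z) mu) * (cos (mu * Carg z), sin (mu * Carg z)))%C.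

(* Sum of a convergent complex series, by real and imaginary parts. *)
Definition CSeries (a : nat -> C) : C :=
  (Series (fun n => Re (a n)), Series (fun n => Im (a n))).

Definition BesselJ (nu : R) (z : C) : C :=
  (CRpower (z / 2) nu *
   CSeries (fun n => RtoC ((-1) ^ n / (INR (fact n) * Gamma (nu + INR n + 1)))
                     * (z / 2) ^ (2 * n)))%C.

Definition BesselI (nu : R) (z : C) : C :=
  (CRpower (z / 2) nu *
   CSeries (fun n => RtoC (1 / (INR (fact n) * Gamma (nu + INR n + 1)))
                     * (z / 2) ^ (2 * n)))%C.

Definition PhiBessel (nu : R) (z : C) : C :=
  (BesselJ nu z * C_derive (BesselI nu) z
   - C_derive (BesselJ nu) z * BesselI nu z)%C.

Definition PiBessel (nu : R) (z : C) : C :=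
  (BesselJ nu z * BesselI nu z)%C.

Definition infinitely_many {T : Type} (P : T -> Prop) : Prop :=
  forall l : list T, exists x, P x /\ ~ In x l.

Definition positive_zero (f : C -> C) (x : R) : Prop :=
  0 < x /\ f (RtoC x) = RtoC 0.

(* For [f = PhiBessel nu] or [PiBessel nu], [f z] is a power of [z] times an
   entire function of [z ^ 4], so a real zero [x] always comes with the zeros
   [Ci * x] and [- Ci * x] on the imaginary axis.  "All zeros are real" can
   therefore only be meant up to this symmetry: every zero is a quarter-turn
   multiple of a real one.  In particular a zero off the imaginary axis is
   real.  The points left out by the slit plane are real. *)
Definition zeros_real_up_to_quarter_turns (f : C -> C) : Prop :=
  forall z : C, slit_plane z -> f z = RtoC 0 ->
    exists (k : nat) (x : R), positive_zero f x /\ z = (Ci ^ k * RtoC x)%C.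

(* Main.v *)
Require Import Defs.
From Stdlib Require Import Reals Ranalysis5 Lra Lia List Factorial.
From Coquelicot Require Import Coquelicot.
Open Scope R_scope.

(** Write [zeta = z^2 / 4] and let [f] be the Bessel-Clifford function
    [f w = sum_n w^n / (n! Gamma (nu + n + 1))], which is entire and solves
    [w f'' + (nu + 1) f' = f].  On the slit plane
    [J z = (z/2)^nu f (- zeta)] and [I z = (z/2)^nu f zeta], so, up to a factor
    without zeros, [Pi z] is [f (- zeta) * f zeta] and [Phi z] is the even function
    [f (- zeta) * f' zeta + f' (- zeta) * f zeta] (lemmas [PiBessel_factor],
    [PhiBessel_factor]).  Everything reduces to two facts about these functions.

    Their zeros are real.  This is the self-adjointness of the vibrating plate
    operator.  With [D y = s y'' + (nu + 1) y'] on the segment [0 <= s <= 1], the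
    functions [s |-> f (zeta s)] and [s |-> f (- zeta s)] satisfy [D y = zeta y] and
    [D y = - zeta y], so each combination [u] of them satisfies [D (D u) = zeta^2 u].
    If [f zeta = 0], then [u s = f (zeta s)] is hinged at [1] ([u = D u = 0]).  A zero
    of [Phi] with [f zeta] nonzero gives a nonzero [u] that is clamped there
    ([u = u' = 0]).  In both cases the flux
    [s^(nu+1) (v' u^* - v u'^* )], with [v = D u], vanishes at [1]; it tends to [0] at
    [0] because [nu > -1]; its derivative is [s^nu (zeta^2 |u|^2 - |v|^2)].  Unless
    [zeta^2] is a nonnegative real number, some constant multiple of this derivative
    has a nonnegative real part that vanishes only with [u] and [v], which is absurd
    (lemmas [plate_energy], [plate_eigenvalue]).  Hence [zeta] is real, and [z] is real
    or purely imaginary.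

    There are infinitely many of them.  Sturm comparison with a sine gives
    arbitrarily large [s] with [f (- s) = 0] ([negative_zeros_unbounded]).  Rolle's
    theorem applied to [f (- s) / f s], whose derivative is, up to a factor without
    zeros, the even function attached to [Phi], does the rest
    ([cross_product_zeros_unbounded]).

    The differential equation for [f] rests on [Gamma (x + 1) = x * Gamma x] and
    [Gamma x > 0], proved from the improper integral ([Gamma_succ], [Gamma_pos]), and on
    termwise differentiation of complex power series along curves
    ([entire_curve_derive]). *)

(** * The Gamma function *)

Lemma is_derive_Rpower (p t : R) :
  0 < t -> is_derive (fun t => Rpower t p) t (p * Rpower t (p - 1)).
Proof.
  intros ht. unfold Rpower. auto_derive; [exact ht|].
  replace ((p - 1) * ln t) with (p * ln t - ln t) by ring.
  unfold Rminus. rewrite exp_plus, exp_Ropp, exp_ln by exact ht. field. lra.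
Qed.

Lemma Rpower_small_near_0 (p e : R) :
  0 < p -> 0 < e -> exists d, 0 < d /\ forall t, 0 < t < d -> Rpower t p < e.
Proof.
  intros hp he. exists (Rpower e (/ p)). split; [apply exp_pos|].
  intros t [ht htd].
  replace e with (Rpower (Rpower e (/ p)) p).
  - apply Rlt_Rpower_l; [exact hp|split; assumption].
  - rewrite Rpower_mult, Rinv_l by lra. apply Rpower_1. exact he.
Qed.

Definition gamma_integrand (x t : R) : R := Rpower t (x - 1) * exp (- t).

Lemma gamma_integrand_pos (x t : R) : 0 < gamma_integrand x t.
Proof. apply Rmult_lt_0_compat; apply exp_pos. Qed.

Lemma continuous_gamma_integrand (x t : R) :
  0 < t -> continuous (gamma_integrand x) t.
Proof.
  intros ht. apply (ex_derive_continuous (gamma_integrand x)).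
  unfold gamma_integrand, Rpower. auto_derive. exact ht.
Qed.

Lemma is_RInt_gamma_integrand (x a b : R) :
  0 < a -> 0 < b -> is_RInt (gamma_integrand x) a b (RInt (gamma_integrand x) a b).
Proof.
  intros ha hb. apply (RInt_correct (gamma_integrand x)). apply ex_RInt_continuous.
  intros t [ht _]. apply continuous_gamma_integrand.
  revert ht. apply Rlt_le_trans. apply Rmin_pos; assumption.
Qed.

Lemma RInt_gamma_integrand_incr (x a b a' b' : R) :
  0 < a' -> a' <= a -> a <= b -> b <= b' ->
  RInt (gamma_integrand x) a b <= RInt (gamma_integrand x) a' b'.
Proof.
  intros h0 h1 h2 h3.
  assert (hex : forall c d, 0 < c -> 0 < d -> ex_RInt (gamma_integrand x) c d)
    by (intros c d hc hd; eexists; apply is_RInt_gamma_integrand; assumption).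
  assert (hpos : forall c d, 0 < c -> c <= d -> 0 <= RInt (gamma_integrand x) c d).
  { intros c d hc hcd. apply RInt_ge_0; [exact hcd|apply hex; lra|].
    intros t _. left; apply gamma_integrand_pos. }
  rewrite <- (RInt_Chasles (gamma_integrand x) a' a b') by (apply hex; lra).
  rewrite <- (RInt_Chasles (gamma_integrand x) a b b') by (apply hex; lra).
  unfold plus; simpl.
  generalize (hpos a' a h0 h1) (hpos b b' ltac:(lra) h3). lra.
Qed.

(** From [ln y <= y - 1] at [y = (1 + t) / p]; equality holds at [1 + t = p], where
    [(1 + t)^p exp (- t)] is largest. *)
Lemma exp_dominates_power (p : R) :
  0 < p -> exists K, 0 < K /\ forall t, 0 < t -> exp (- t) <= K * Rpower (1 + t) (- p).
Proof.
  intros hp. exists (exp (1 - p + p * ln p)). split; [apply exp_pos|].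
  intros t ht. unfold Rpower. rewrite <- exp_plus.
  assert (h : ln (1 + t) <= (1 + t) / p - 1 + ln p).
  { assert (hq : 0 < (1 + t) / p) by (apply Rdiv_lt_0_compat; lra).
    generalize (exp_ineq1_le (ln ((1 + t) / p))).
    rewrite exp_ln by exact hq. rewrite ln_div by lra. lra. }
  apply (Rmult_le_compat_l p) in h; [|lra].
  replace (p * ((1 + t) / p - 1 + ln p)) with (1 + t - p + p * ln p) in h by (field; lra).
  destruct (Rle_lt_or_eq_dec (-t) (1 - p + p * ln p + - p * ln (1 + t))) as [h1|h1]; [lra| |].
  - left. apply exp_increasing. exact h1.
  - right. rewrite h1 at 1. reflexivity.
Qed.

(** One majorant serves both ends of the half-line: by [exp_dominates_power] the
    integrand is at most a constant times the derivative of [(t / (1 + t))^x], and the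
    latter primitive stays between [0] and [1]. *)
Lemma RInt_gamma_integrand_bounded (x : R) :
  0 < x -> exists M, forall a b, 0 < a -> a <= b -> RInt (gamma_integrand x) a b <= M.
Proof.
  intros hx.
  destruct (exp_dominates_power (x + 1)) as [K [hK hdom]]; [lra|].
  set (F := fun t => K / x * Rpower (t / (1 + t)) x).
  set (dF := fun t => K * (Rpower t (x - 1) * Rpower (1 + t) (- (x + 1)))).
  assert (hF : forall t, 0 < t -> is_derive F t (dF t)).
  { intros t ht. unfold F, dF, Rpower.
    assert (hq : 0 < t / (1 + t)) by (apply Rdiv_lt_0_compat; lra).
    auto_derive; [split; [lra|split; [exact hq|exact I]]|].
    replace (t * / (1 + t)) with (t / (1 + t)) by reflexivity.
    rewrite ln_div by lra. rewrite <- exp_plus.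
    replace ((x - 1) * ln t + - (x + 1) * ln (1 + t))
      with (x * (ln t - ln (1 + t)) + - ln t + - ln (1 + t)) by ring.
    rewrite !exp_plus, !exp_Ropp, !exp_ln by lra. field. lra. }
  assert (hc : forall t, 0 < t -> continuous dF t).
  { intros t ht. apply (ex_derive_continuous dF). unfold dF, Rpower.
    auto_derive. repeat split; lra. }
  exists (K / x). intros a b ha hab.
  assert (hI : is_RInt dF a b (F b - F a)).
  { apply (is_RInt_derive F dF).
    - intros t [ht _]. apply hF. rewrite Rmin_left in ht; lra.
    - intros t [ht _]. apply hc. rewrite Rmin_left in ht; lra. }
  apply Rle_trans with (RInt dF a b).
  - apply RInt_le.
    + exact hab.
    + eexists; apply is_RInt_gamma_integrand; lra.
    + eexists; exact hI.
    + intros t ht. unfold gamma_integrand, dF.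
      rewrite <- Rmult_assoc, (Rmult_comm K), Rmult_assoc.
      apply Rmult_le_compat_l; [left; apply exp_pos|]. apply hdom. lra.
  - rewrite (is_RInt_unique _ _ _ _ hI).
    assert (hFa : 0 <= F a).
    { apply Rmult_le_pos; [left; apply Rdiv_lt_0_compat; lra|left; apply exp_pos]. }
    assert (hFb : F b <= K / x * 1).
    { apply Rmult_le_compat_l; [left; apply Rdiv_lt_0_compat; lra|].
      replace 1 with (Rpower 1 x) at 2
        by (unfold Rpower; rewrite ln_1, Rmult_0_r; apply exp_0).
      apply Rle_Rpower_l; [lra|]. split.
      - apply Rdiv_lt_0_compat; lra.
      - apply Rmult_le_reg_r with (1 + b); [lra|]. unfold Rdiv.
        rewrite Rmult_assoc, Rinv_l by lra. lra. }
    lra.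
Qed.

(** The integrand is positive, so the improper integral is the supremum of the
    integrals over the segments [a, b] with [0 < a]. *)
Lemma gamma_integral_converges (x : R) :
  0 < x -> exists l, 0 < l /\
    is_RInt_gen (gamma_integrand x) (at_right 0) (Rbar_locally p_infty) l.
Proof.
  intros hx.
  destruct (RInt_gamma_integrand_bounded x hx) as [M hM].
  set (E := fun r => exists a b, 0 < a /\ a <= b /\ r = RInt (gamma_integrand x) a b).
  destruct (completeness E) as [l [hub hlub]].
  - exists M. intros r (a & b & ha & hab & ->). apply hM; assumption.
  - exists (RInt (gamma_integrand x) 1 2), 1, 2. repeat split; lra.
  - exists l. split.
    + apply Rlt_le_trans with (RInt (gamma_integrand x) 1 2).
      * apply RInt_gt_0; [lra| |].
        -- intros; apply gamma_integrand_pos.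
        -- intros t ht; apply continuous_gamma_integrand; lra.
      * apply hub. exists 1, 2. repeat split; lra.
    + intros P [eps hP].
      assert (hnear : exists a b, 0 < a /\ a <= b /\ l - eps < RInt (gamma_integrand x) a b).
      { apply Classical_Prop.NNPP. intros hno.
        assert (hle : l <= l - eps).
        { apply hlub. intros r (a & b & ha & hab & ->).
          apply Rnot_lt_le. intros hlt. apply hno. exists a, b. repeat split; assumption. }
        generalize (cond_pos eps). lra. }
      destruct hnear as (a0 & b0 & ha0 & hab0 & hlt).
      unfold filtermapi.
      apply Filter_prod with (Q := fun a => 0 < a < a0) (R := fun b => b0 < b).
      * exists (mkposreal a0 ha0). intros y hy h0y. split; [exact h0y|].
        unfold ball in hy; simpl in hy. unfold AbsRing_ball, abs, minus, plus, opp in hy.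
        simpl in hy. apply Rabs_def2 in hy. lra.
      * exists b0. intros y hy; exact hy.
      * intros a b [ha ha'] hb. simpl.
        exists (RInt (gamma_integrand x) a b). split.
        -- apply is_RInt_gamma_integrand; lra.
        -- apply hP. unfold ball; simpl. unfold AbsRing_ball, abs, minus, plus, opp; simpl.
           assert (h1 : RInt (gamma_integrand x) a b <= l)
             by (apply hub; exists a, b; repeat split; lra).
           assert (h2 := RInt_gamma_integrand_incr x a0 b0 a b ha ltac:(lra) hab0 ltac:(lra)).
           apply Rabs_def1; generalize (cond_pos eps); lra.
Qed.

Lemma Gamma_eq (x l : R) :
  is_RInt_gen (gamma_integrand x) (at_right 0) (Rbar_locally p_infty) l -> Gamma x = l.
Proof.
  exact (is_RInt_gen_unique (V := R_CompleteNormedModule) (gamma_integrand x) l).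
Qed.

Lemma is_RInt_gen_Gamma (x : R) :
  0 < x ->
  is_RInt_gen (gamma_integrand x) (at_right 0) (Rbar_locally p_infty) (Gamma x).
Proof.
  intros hx. destruct (gamma_integral_converges x hx) as [l [_ hl]].
  rewrite (Gamma_eq x l hl). exact hl.
Qed.

Lemma Gamma_pos (x : R) : 0 < x -> 0 < Gamma x.
Proof.
  intros hx. destruct (gamma_integral_converges x hx) as [l [hl hl']].
  rewrite (Gamma_eq x l hl'). exact hl.
Qed.

(** Integration by parts: [t^x exp (- t)] tends to [0] at both ends. *)
Lemma Gamma_succ (x : R) : 0 < x -> Gamma (x + 1) = x * Gamma x.
Proof.
  intros hx.
  set (F := fun t => Rpower t x * exp (- t)).
  set (dF := fun t => x * gamma_integrand x t - gamma_integrand (x + 1) t).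
  assert (hder : forall t, 0 < t -> is_derive F t (dF t)).
  { intros t ht. unfold F, dF, gamma_integrand, Rpower.
    auto_derive; [exact ht|].
    replace (x + 1 - 1) with x by ring.
    replace ((x - 1) * ln t) with (x * ln t - ln t) by ring.
    unfold Rminus. rewrite !exp_plus, !exp_Ropp, !exp_ln by exact ht. field.
    split; [apply Rgt_not_eq, exp_pos|lra]. }
  assert (hcont : forall t, 0 < t -> continuous dF t).
  { intros t ht.
    apply (continuous_minus (fun t => x * gamma_integrand x t) (gamma_integrand (x + 1))).
    - apply (continuous_scal_r x (gamma_integrand x)). apply continuous_gamma_integrand; exact ht.
    - apply continuous_gamma_integrand; exact ht. }
  assert (hpos : filter_prod (at_right 0) (Rbar_locally p_infty)
     (fun ab => 0 < fst ab /\ 0 < snd ab)).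
  { apply Filter_prod with (Q := fun a => 0 < a) (R := fun b => 0 < b).
    - exists (mkposreal 1 Rlt_0_1). intros y _ hy; exact hy.
    - exists 0; intros y hy; exact hy.
    - intros a b ha hb; split; assumption. }
  assert (hloc : forall t, 0 < t -> locally t (fun y => 0 < y))
    by (intros t ht; apply (open_gt 0); exact ht).
  assert (hD : is_RInt_gen (Derive F) (at_right 0) (Rbar_locally p_infty) (0 - 0)).
  { apply is_RInt_gen_Derive.
    - revert hpos. apply filter_imp. intros [a b] [ha hb] t [ht _].
      eexists. apply hder. apply Rlt_le_trans with (2 := ht). apply Rmin_pos; assumption.
    - revert hpos. apply filter_imp. intros [a b] [ha hb] t [ht _].
      assert (ht' : 0 < t) by (apply Rlt_le_trans with (2 := ht); apply Rmin_pos; assumption).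
      apply continuous_ext_loc with dF.
      + generalize (hloc t ht'). apply filter_imp. intros y hy. symmetry.
        apply is_derive_unique. apply hder. exact hy.
      + apply hcont. exact ht'.
    - intros P [eps hP].
      destruct (Rpower_small_near_0 x eps hx (cond_pos eps)) as [d [hd hsmall]].
      exists (mkposreal d hd). intros y hy h0y. apply hP.
      unfold ball in hy |- *; simpl in hy |- *.
      unfold AbsRing_ball, abs, minus, plus, opp in hy |- *; simpl in hy |- *.
      apply Rabs_def2 in hy.
      assert (h1 := hsmall y ltac:(lra)).
      assert (h2 : exp (- y) < 1) by (rewrite <- exp_0; apply exp_increasing; lra).
      assert (h3 : 0 < Rpower y x) by apply exp_pos.
      assert (h4 := exp_pos (- y)).
      unfold F. rewrite Rabs_pos_eq by nra. nra.
    - intros P [eps hP].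
      destruct (exp_dominates_power (x + 1)) as [K [hK hdom]]; [lra|].
      exists (K / eps). intros y hy. apply hP.
      unfold ball; simpl. unfold AbsRing_ball, abs, minus, plus, opp; simpl.
      assert (he := cond_pos eps).
      assert (h0 : 0 < K / eps) by (apply Rdiv_lt_0_compat; lra).
      assert (h1 := hdom y ltac:(lra)).
      assert (hF0 : 0 < F y) by (apply Rmult_lt_0_compat; apply exp_pos).
      assert (h2 : Rpower y x <= Rpower (1 + y) x) by (apply Rle_Rpower_l; lra).
      assert (h3 : F y <= K / (1 + y)).
      { unfold F. apply Rle_trans with (Rpower (1 + y) x * (K * Rpower (1 + y) (- (x + 1)))).
        - apply Rmult_le_compat; try (left; apply exp_pos); assumption.
        - right. replace (- (x + 1)) with (- x + Ropp 1) by ring.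
          rewrite Rpower_plus, !Rpower_Ropp, (Rpower_1 (1 + y)) by lra.
          field. split; [lra|]. apply Rgt_not_eq, exp_pos. }
      assert (h4 : K / (1 + y) < eps).
      { apply Rmult_lt_reg_r with (1 + y); [lra|].
        unfold Rdiv. rewrite Rmult_assoc, Rinv_l by lra.
        apply (Rmult_lt_compat_l eps) in hy; [|lra].
        replace (eps * (K / eps)) with K in hy by (field; lra). lra. }
      rewrite Rabs_pos_eq; lra. }
  assert (hD' : is_RInt_gen (Derive F) (at_right 0) (Rbar_locally p_infty)
                  (x * Gamma x - Gamma (x + 1))).
  { apply is_RInt_gen_ext with dF.
    - revert hpos. apply filter_imp. intros [a b] [ha hb] t [ht _].
      symmetry. apply is_derive_unique. apply hder.
      simpl in *. apply Rlt_trans with (2 := ht). apply Rmin_pos; assumption.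
    - apply (is_RInt_gen_minus (fun t => x * gamma_integrand x t)).
      + apply (is_RInt_gen_scal (gamma_integrand x) x). apply is_RInt_gen_Gamma. exact hx.
      + apply is_RInt_gen_Gamma. lra. }
  apply (is_RInt_gen_unique (V := R_CompleteNormedModule)) in hD.
  apply (is_RInt_gen_unique (V := R_CompleteNormedModule)) in hD'. lra.
Qed.

(** * Complex-valued curves *)

(** Componentwise, since [CSeries] and [C_derive] are themselves defined through real
    and imaginary parts. *)
Definition curve_derive (g : R -> C) (t : R) (l : C) : Prop :=
  is_derive (fun s => Re (g s)) t (Re l) /\ is_derive (fun s => Im (g s)) t (Im l).

Lemma curve_derive_eq (g : R -> C) (t : R) (l l' : C) :
  curve_derive g t l -> l = l' -> curve_derive g t l'.
Proof. intros h <-. exact h. Qed.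

Lemma curve_derive_mult (g k : R -> C) (t : R) (lg lk : C) :
  curve_derive g t lg -> curve_derive k t lk ->
  curve_derive (fun s => g s * k s)%C t (lg * k t + g t * lk)%C.
Proof.
  intros [g1 g2] [k1 k2]. split; simpl; unfold Re, Im in *; simpl.
  - evar_last.
    + apply @is_derive_minus; apply @is_derive_mult; eauto; intros; apply Rmult_comm.
    + unfold minus, plus, opp, mult; simpl. ring.
  - evar_last.
    + apply @is_derive_plus; apply @is_derive_mult; eauto; intros; apply Rmult_comm.
    + unfold plus, mult; simpl. ring.
Qed.

Lemma curve_derive_minus (g k : R -> C) (t : R) (lg lk : C) :
  curve_derive g t lg -> curve_derive k t lk ->
  curve_derive (fun s => g s - k s)%C t (lg - lk)%C.
Proof.
  intros [g1 g2] [k1 k2].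
  split; [apply (is_derive_minus _ _ _ _ _ g1 k1)|apply (is_derive_minus _ _ _ _ _ g2 k2)].
Qed.

Lemma curve_derive_plus (g k : R -> C) (t : R) (lg lk : C) :
  curve_derive g t lg -> curve_derive k t lk ->
  curve_derive (fun s => g s + k s)%C t (lg + lk)%C.
Proof.
  intros [g1 g2] [k1 k2].
  split; [apply (is_derive_plus _ _ _ _ _ g1 k1)|apply (is_derive_plus _ _ _ _ _ g2 k2)].
Qed.

Lemma curve_derive_const (c : C) (t : R) : curve_derive (fun _ => c) t (RtoC 0).
Proof. split; apply (is_derive_const (V := R_NormedModule)). Qed.

Lemma curve_derive_scal (c : C) (g : R -> C) (t : R) (l : C) :
  curve_derive g t l -> curve_derive (fun s => c * g s)%C t (c * l)%C.
Proof.
  intros hg. eapply curve_derive_eq.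
  - apply curve_derive_mult; [apply curve_derive_const|exact hg].
  - simpl. ring.
Qed.

Lemma curve_derive_conj (g : R -> C) (t : R) (l : C) :
  curve_derive g t l -> curve_derive (fun s => Cconj (g s)) t (Cconj l).
Proof.
  intros [g1 g2]. split; [exact g1|]. apply (is_derive_opp _ _ _ g2).
Qed.

Lemma curve_derive_continuous (g : R -> C) (t : R) (l : C) :
  curve_derive g t l -> continuous (fun s => Re (g s)) t /\ continuous (fun s => Im (g s)) t.
Proof.
  intros [g1 g2]. split.
  - apply (ex_derive_continuous (fun s => Re (g s))). eexists; exact g1.
  - apply (ex_derive_continuous (fun s => Im (g s))). eexists; exact g2.
Qed.

Lemma curve_derive_ray (c : C) (s : R) : curve_derive (fun s => c * RtoC s)%C s c.
Proof.
  eapply curve_derive_eq with (c * RtoC 1)%C; [|ring].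
  apply curve_derive_scal. split.
  - apply (is_derive_id (K := R_AbsRing)).
  - change (is_derive (fun _ : R => 0) s 0). apply (is_derive_const (V := R_NormedModule)).
Qed.

(** [C_derive] is a limit along the horizontal line through the point, so the
    derivative along that single curve determines it. *)
Lemma C_derive_of_horizontal (f : C -> C) (z l : C) :
  curve_derive (fun t => f (t, snd z)) (fst z) l -> C_derive f z = l.
Proof.
  assert (hlim : forall (p q : R -> R) (x d : R),
    is_derive p x d -> (forall y, y <> x -> q y = (p y - p x) / (y - x)) ->
    real (Lim q x) = d).
  { intros p q x d hp hq.
    replace (Lim q x) with (Finite d); [reflexivity|]. symmetry.
    apply is_lim_unique, is_lim_spec. intros eps.
    apply is_derive_Reals in hp.
    destruct (hp eps (cond_pos eps)) as [del hdel].
    exists del. intros y hy hyx. change R in y.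
    unfold ball in hy; simpl in hy. unfold AbsRing_ball, abs, minus, plus, opp in hy.
    simpl in hy. rewrite hq by exact hyx.
    specialize (hdel (y - x)). replace (x + (y - x)) with y in hdel by ring.
    apply hdel; [lra|exact hy]. }
  assert (hq : forall y, y <> fst z -> ((f (y, snd z) - f z) / ((y, snd z) - z))%C
     = ((Re (f (y, snd z)) - Re (f z)) / (y - fst z),
        (Im (f (y, snd z)) - Im (f z)) / (y - fst z))).
  { intros y hy. destruct z as [x0 y0].
    set (A := f (y, snd (x0, y0))). set (B := f (x0, y0)). simpl in *.
    unfold Cdiv, Cinv, Cmult, Cminus, Cplus, Copp, Re, Im. simpl.
    assert (y - x0 <> 0) by lra.
    f_equal; field; try split; try lra;
      replace (y0 + - y0) with 0 by ring; intros h0; apply H; nra. }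
  intros [h1 h2]. destruct l as [l1 l2]. unfold C_derive, C_lim. f_equal.
  - apply (hlim _ _ _ _ h1). intros y hy. rewrite hq by exact hy.
    destruct z; reflexivity.
  - apply (hlim _ _ _ _ h2). intros y hy. rewrite hq by exact hy.
    destruct z; reflexivity.
Qed.

(** * Absolutely convergent complex series *)

Definition abs_summable (b : nat -> C) : Prop := ex_series (fun n => Cmod (b n)).

Lemma im_le_Cmod (c : C) : Rabs (Im c) <= Cmod c.
Proof.
  apply Rle_trans with (2 := Rmax_Cmod c). apply Rmax_r.
Qed.

Lemma abs_summable_Re (b : nat -> C) : abs_summable b -> ex_series (fun n => Re (b n)).
Proof.
  intros h. apply (ex_series_le (V := R_CompleteNormedModule)) with (2 := h).
  intros n. apply re_le_Cmod.
Qed.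

Lemma abs_summable_Im (b : nat -> C) : abs_summable b -> ex_series (fun n => Im (b n)).
Proof.
  intros h. apply (ex_series_le (V := R_CompleteNormedModule)) with (2 := h).
  intros n. apply im_le_Cmod.
Qed.

Lemma CSeries_ext (b b' : nat -> C) :
  (forall n, b n = b' n) -> CSeries b = CSeries b'.
Proof.
  intros h. unfold CSeries. f_equal; apply Series_ext; intros n; rewrite h; reflexivity.
Qed.

Lemma CSeries_plus (b b' : nat -> C) :
  abs_summable b -> abs_summable b' ->
  CSeries (fun n => b n + b' n)%C = (CSeries b + CSeries b')%C.
Proof.
  intros h h'. unfold CSeries, Cplus; simpl. f_equal.
  - rewrite <- Series_plus by (apply abs_summable_Re; assumption).
    reflexivity.
  - rewrite <- Series_plus by (apply abs_summable_Im; assumption).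
    reflexivity.
Qed.

Lemma CSeries_scal (c : C) (b : nat -> C) :
  abs_summable b -> CSeries (fun n => c * b n)%C = (c * CSeries b)%C.
Proof.
  intros h. assert (h1 := abs_summable_Re b h). assert (h2 := abs_summable_Im b h).
  assert (hs : forall r a, ex_series a -> ex_series (fun n => r * a n)).
  { intros r a ha. apply (ex_series_scal (V := R_NormedModule) r a ha). }
  unfold CSeries, Cmult; simpl. f_equal.
  - rewrite <- !Series_scal_l.
    rewrite <- (Series_minus (fun n => fst c * Re (b n))) by (apply hs; assumption).
    reflexivity.
  - rewrite <- !Series_scal_l.
    rewrite <- (Series_plus (fun n => fst c * Im (b n))) by (apply hs; assumption).
    reflexivity.
Qed.

Lemma CSeries_incr_1 (b : nat -> C) :
  abs_summable b -> CSeries b = (b O + CSeries (fun n => b (S n)))%C.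
Proof.
  intros h. unfold CSeries, Cplus; simpl. f_equal.
  - rewrite Series_incr_1 by (apply abs_summable_Re; assumption). reflexivity.
  - rewrite Series_incr_1 by (apply abs_summable_Im; assumption). reflexivity.
Qed.

Lemma abs_summable_le (b : nat -> C) (m : nat -> R) :
  (forall n, Cmod (b n) <= m n) -> ex_series m -> abs_summable b.
Proof.
  intros hb hm. apply (ex_series_le (V := R_CompleteNormedModule)) with (2 := hm).
  intros n. unfold norm; simpl. unfold abs; simpl. rewrite Rabs_pos_eq by apply Cmod_ge_0.
  apply hb.
Qed.

Lemma Cmod_le_components (c : C) (m : R) :
  Rabs (Re c) <= m -> Rabs (Im c) <= m -> Cmod c <= 2 * m.
Proof.
  intros h1 h2. apply Rle_trans with (1 := Cmod_2Rmax c).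
  assert (hm : 0 <= m) by (apply Rle_trans with (2 := h1); apply Rabs_pos).
  assert (hs : sqrt 2 <= 2).
  { rewrite <- (sqrt_square 2) at 2 by lra. apply sqrt_le_1_alt. lra. }
  apply Rmult_le_compat; [apply sqrt_pos| |exact hs|apply Rmax_lub; assumption].
  apply Rle_trans with (2 := Rmax_l _ _). apply Rabs_pos.
Qed.

Lemma Cmod_CSeries_le (b : nat -> C) (m : nat -> R) :
  (forall n, Cmod (b n) <= m n) -> ex_series m -> Cmod (CSeries b) <= 2 * Series m.
Proof.
  intros hb hm.
  assert (hcomp : forall p : C -> R, (forall c, Rabs (p c) <= Cmod c) ->
     Rabs (Series (fun n => p (b n))) <= Series m).
  { intros p hp. apply Rle_trans with (Series (fun n => Rabs (p (b n)))).
    - apply Series_Rabs.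
      apply (ex_series_le (V := R_CompleteNormedModule)) with (2 := hm).
      intros n. unfold norm; simpl. unfold abs; simpl. rewrite Rabs_Rabsolu.
      apply Rle_trans with (1 := hp _). apply hb.
    - apply Series_le; [|exact hm]. intros n. split; [apply Rabs_pos|].
      apply Rle_trans with (1 := hp _). apply hb. }
  apply Cmod_le_components.
  - apply (hcomp Re). apply re_le_Cmod.
  - apply (hcomp Im). apply im_le_Cmod.
Qed.

(** * Entire functions with real coefficients *)

(** Meant for coefficients with [CV_radius a = p_infty]. *)
Definition entire_sum (a : nat -> R) (w : C) : C := CSeries (fun n => RtoC (a n) * w ^ n)%C.

Lemma entire_majorant (a : nat -> R) (r : R) :
  CV_radius a = p_infty -> 0 <= r -> ex_series (fun n => Rabs (a n) * r ^ n).
Proof.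
  intros ha hr. apply ex_series_ext with (fun n => Rabs (a n * r ^ n)).
  - intros n. rewrite Rabs_mult, (Rabs_pos_eq (r ^ n)) by (apply pow_le; exact hr). reflexivity.
  - apply CV_disk_inside. rewrite ha. exact I.
Qed.

Lemma entire_abs_summable (a : nat -> R) (w : C) :
  CV_radius a = p_infty -> abs_summable (fun n => RtoC (a n) * w ^ n)%C.
Proof.
  intros ha. apply abs_summable_le with (fun n => Rabs (a n) * Cmod w ^ n).
  - intros n. rewrite Cmod_mult, Cmod_R, Cmod_pow. lra.
  - apply entire_majorant; [exact ha|apply Cmod_ge_0].
Qed.

Lemma entire_derive (a : nat -> R) :
  CV_radius a = p_infty -> CV_radius (PS_derive a) = p_infty.
Proof. intros ha. rewrite CV_radius_derive. exact ha. Qed.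

(** Second-order remainder of [w^n].  The remainders [E n] satisfy
    [E (n+1) = (w + h) E n + n w^(n-1) h^2], so the factor [n^2] absorbs
    [n^2 + n <= (n + 1)^2].  The exponent [pred n] is harmless at [n = 0], where its
    coefficient vanishes. *)
Lemma Cpow_taylor (w h : C) (r : R) (n : nat) :
  1 <= r -> Cmod w + Cmod h <= r ->
  Cmod ((w + h) ^ n - w ^ n - RtoC (INR n) * h * w ^ pred n)%C
    <= INR n ^ 2 * r ^ n * Cmod h ^ 2.
Proof.
  intros hr hwh.
  assert (hw0 := Cmod_ge_0 w). assert (hh0 := Cmod_ge_0 h).
  induction n as [|n IH].
  - simpl. replace (1 - 1 - 0 * h * 1)%C with (RtoC 0) by ring. rewrite Cmod_0. lra.
  - set (E := ((w + h) ^ n - w ^ n - RtoC (INR n) * h * w ^ pred n)%C) in IH.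
    replace ((w + h) ^ S n - w ^ S n - RtoC (INR (S n)) * h * w ^ pred (S n))%C
      with ((w + h) * E + RtoC (INR n) * w ^ pred n * (h * h))%C.
    2:{ unfold E. rewrite S_INR, RtoC_plus. destruct n; simpl pred; rewrite !Cpow_S.
        - simpl. ring.
        - ring. }
    apply Rle_trans with (1 := Cmod_triangle _ _).
    rewrite !Cmod_mult, Cmod_R, Cmod_pow, (Rabs_pos_eq (INR n)) by apply pos_INR.
    assert (hn := pos_INR n).
    assert (hp : Cmod w ^ pred n <= r ^ S n).
    { apply Rle_trans with (r ^ pred n).
      - apply pow_incr. lra.
      - apply Rle_pow; [exact hr|lia]. }
    assert (h1 : Cmod (w + h) * Cmod E <= r * (INR n ^ 2 * r ^ n * Cmod h ^ 2)).
    { apply Rmult_le_compat; try apply Cmod_ge_0; [|exact IH].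
      apply Rle_trans with (2 := hwh). apply Cmod_triangle. }
    assert (h2 : INR n * Cmod w ^ pred n * (Cmod h * Cmod h)
                 <= INR n * r ^ S n * (Cmod h * Cmod h)).
    { apply Rmult_le_compat_r; [apply Rmult_le_pos; assumption|].
      apply Rmult_le_compat_l; assumption. }
    assert (h3 : 0 <= (INR n + 1) * (r ^ S n * Cmod h ^ 2)).
    { apply Rmult_le_pos; [lra|]. apply Rmult_le_pos; apply pow_le; lra. }
    rewrite S_INR. simpl pow in *. nra.
Qed.

Lemma INR_le_pow2 (n : nat) : INR n <= 2 ^ n.
Proof. generalize (poly n 1 Rlt_0_1). replace (1 + 1) with 2 by ring. lra. Qed.

(** Summation of [Cpow_taylor]; since [n^2 <= 4^n], the remainder is dominated by the
    series at radius [4 r]. *)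
Lemma entire_taylor (a : nat -> R) (w : C) :
  CV_radius a = p_infty ->
  exists K, forall h, Cmod h <= 1 ->
    Cmod (entire_sum a (w + h) - entire_sum a w - h * entire_sum (PS_derive a) w)%C
      <= K * Cmod h ^ 2.
Proof.
  intros ha. set (r := Cmod w + 1).
  assert (hw := Cmod_ge_0 w).
  set (m := fun n => Rabs (a n) * (4 * r) ^ n).
  assert (hm : ex_series m) by (apply entire_majorant; [exact ha|unfold r; lra]).
  exists (2 * Series m). intros h hh.
  set (b1 := fun n => (RtoC (a n) * w ^ n)%C).
  set (b2 := fun n => (RtoC (a n) * (RtoC (INR n) * h * w ^ pred n))%C).
  set (b3 := fun n => (RtoC (a n) *
     ((w + h) ^ n - w ^ n - RtoC (INR n) * h * w ^ pred n))%C).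
  assert (s1 : abs_summable b1) by (apply entire_abs_summable; exact ha).
  assert (s2 : abs_summable b2).
  { apply abs_summable_le with (fun n => Cmod h * (Rabs (a n) * (2 * r) ^ n)).
    - intros n. unfold b2. rewrite !Cmod_mult, !Cmod_R, Cmod_pow.
      rewrite (Rabs_pos_eq (INR n)) by apply pos_INR.
      rewrite Rpow_mult_distr.
      replace (Cmod h * (Rabs (a n) * (2 ^ n * r ^ n)))
        with (Rabs (a n) * (2 ^ n * Cmod h * r ^ n)) by ring.
      apply Rmult_le_compat_l; [apply Rabs_pos|].
      apply Rmult_le_compat.
      + apply Rmult_le_pos; [apply pos_INR|apply Cmod_ge_0].
      + apply pow_le. exact hw.
      + apply Rmult_le_compat_r; [apply Cmod_ge_0|]. apply INR_le_pow2.
      + apply Rle_trans with (r ^ pred n).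
        * apply pow_incr. unfold r. lra.
        * apply Rle_pow; [unfold r; lra|lia].
    - apply (ex_series_scal (V := R_NormedModule) (Cmod h)).
      apply entire_majorant; [exact ha|unfold r; lra]. }
  assert (hb3 : forall n, Cmod (b3 n) <= Cmod h ^ 2 * m n).
  { intros n. unfold b3, m. rewrite Cmod_mult, Cmod_R.
    replace (Cmod h ^ 2 * (Rabs (a n) * (4 * r) ^ n))
      with (Rabs (a n) * ((4 * r) ^ n * Cmod h ^ 2)) by ring.
    apply Rmult_le_compat_l; [apply Rabs_pos|].
    apply Rle_trans with (INR n ^ 2 * r ^ n * Cmod h ^ 2).
    - apply Cpow_taylor; unfold r; lra.
    - apply Rmult_le_compat_r; [apply pow_le, Cmod_ge_0|].
      rewrite Rpow_mult_distr. apply Rmult_le_compat_r; [apply pow_le; unfold r; lra|].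
      replace (4 ^ n) with ((2 ^ n) ^ 2)
        by (rewrite <- pow_mult, Nat.mul_comm, pow_mult; f_equal; ring).
      apply pow_incr. split; [apply pos_INR|apply INR_le_pow2]. }
  assert (hm' : ex_series (fun n => Cmod h ^ 2 * m n))
    by (apply (ex_series_scal (V := R_NormedModule) (Cmod h ^ 2) m); exact hm).
  assert (s3 : abs_summable b3) by (apply abs_summable_le with (1 := hb3); exact hm').
  assert (hshift : (h * entire_sum (PS_derive a) w)%C = CSeries b2).
  { unfold entire_sum. rewrite <- CSeries_scal
      by (apply entire_abs_summable, entire_derive; exact ha).
    rewrite (CSeries_incr_1 b2) by exact s2. unfold b2 at 1.
    simpl (INR 0). rewrite !Cmult_0_l, Cmult_0_r, Cplus_0_l.
    apply CSeries_ext. intros n. unfold b2, PS_derive. simpl pred.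
    rewrite RtoC_mult. ring. }
  assert (hsplit : entire_sum a (w + h) = (CSeries b1 + (CSeries b2 + CSeries b3))%C).
  { rewrite <- (CSeries_plus b2 b3) by assumption.
    rewrite <- CSeries_plus.
    - apply CSeries_ext. intros n. unfold b1, b2, b3. ring.
    - exact s1.
    - apply (ex_series_le (V := R_CompleteNormedModule)) with
        (fun n => Cmod (b2 n) + Cmod (b3 n)).
      + intros n. unfold norm; simpl. unfold abs; simpl.
        rewrite Rabs_pos_eq by apply Cmod_ge_0. apply Cmod_triangle.
      + apply (ex_series_plus (V := R_NormedModule)); assumption. }
  rewrite hshift, hsplit. change (entire_sum a w) with (CSeries b1).
  replace (CSeries b1 + (CSeries b2 + CSeries b3) - CSeries b1 - CSeries b2)%C
    with (CSeries b3) by ring.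
  replace (2 * Series m * Cmod h ^ 2) with (2 * (Cmod h ^ 2 * Series m)) by ring.
  rewrite <- Series_scal_l. apply Cmod_CSeries_le; assumption.
Qed.

Lemma is_derive_0_squeeze (p q : R -> R) (t : R) :
  p t = 0 -> q t = 0 -> locally t (fun s => Rabs (p s) <= q s) ->
  is_derive q t 0 -> is_derive p t 0.
Proof.
  intros hp hq [d hd] hder. apply is_derive_Reals. apply is_derive_Reals in hder.
  intros eps heps. destruct (hder eps heps) as [d' hd'].
  assert (hmin : 0 < Rmin d d') by (apply Rmin_pos; apply cond_pos).
  exists (mkposreal _ hmin). simpl. intros h h0 hh.
  specialize (hd' h h0 (Rlt_le_trans _ _ _ hh (Rmin_r _ _))).
  assert (hb : Rabs (p (t + h)) <= q (t + h)).
  { apply hd. unfold ball; simpl. unfold AbsRing_ball, abs, minus, plus, opp; simpl.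
    replace (t + h + - t) with h by ring.
    apply Rlt_le_trans with (1 := hh). apply Rmin_l. }
  rewrite hp, hq in *. apply Rle_lt_trans with (2 := hd').
  rewrite !Rminus_0_r. unfold Rdiv. rewrite !Rabs_mult.
  apply Rmult_le_compat_r; [apply Rabs_pos|].
  apply Rle_trans with (1 := hb). apply Rle_abs.
Qed.

Lemma is_derive_affine_plus_flat (r u v : R -> R) (t du dv c u0 v0 al be : R) :
  is_derive r t 0 -> is_derive u t du -> is_derive v t dv ->
  is_derive (fun s => r s + (c + ((u s - u0) * al + (v s - v0) * be))) t (du * al + dv * be).
Proof.
  intros hr hu hv. auto_derive.
  - repeat split; eexists; eassumption.
  - replace (Derive (fun s => r s) t) with 0 by (symmetry; exact (is_derive_unique _ _ _ hr)).
    replace (Derive (fun s => u s) t) with du by (symmetry; exact (is_derive_unique _ _ _ hu)).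
    replace (Derive (fun s => v s) t) with dv by (symmetry; exact (is_derive_unique _ _ _ hv)).
    ring.
Qed.

Lemma is_derive_square_dist (u v : R -> R) (t du dv K : R) :
  is_derive u t du -> is_derive v t dv ->
  is_derive (fun s => K * ((u s - u t) ^ 2 + (v s - v t) ^ 2)) t 0.
Proof.
  intros hu hv. auto_derive.
  - repeat split; eexists; eassumption.
  - ring.
Qed.

(** Chain rule.  By [entire_taylor] the increment along the curve is a linear function
    of the increment of the curve, up to a quadratic error, which has derivative
    [0]. *)
Lemma entire_curve_derive (a : nat -> R) (g : R -> C) (t : R) (l : C) :
  CV_radius a = p_infty -> curve_derive g t l ->
  curve_derive (fun s => entire_sum a (g s)) t (entire_sum (PS_derive a) (g t) * l)%C.
Proof.
  intros ha [hg1 hg2].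
  destruct (entire_taylor a (g t) ha) as [K hK].
  set (D := entire_sum (PS_derive a) (g t)).
  set (q := fun s => K * ((Re (g s) - Re (g t)) ^ 2 + (Im (g s) - Im (g t)) ^ 2)).
  set (rem := fun s => (entire_sum a (g s) - entire_sum a (g t) - (g s - g t) * D)%C).
  assert (hloc : locally t (fun s => Cmod (rem s) <= q s)).
  { assert (c1 := ex_derive_continuous (fun s => Re (g s)) t (ex_intro _ _ hg1)).
    assert (c2 := ex_derive_continuous (fun s => Im (g s)) t (ex_intro _ _ hg2)).
    assert (hhalf : 0 < / 2) by lra.
    assert (hball : forall v, locally v (fun v' => Rabs (v' - v) < / 2)).
    { intros v. exists (mkposreal _ hhalf). intros y hy. exact hy. }
    assert (d1 : locally t (fun s => Rabs (Re (g s) - Re (g t)) < / 2))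
      by exact (c1 _ (hball _)).
    assert (d2 : locally t (fun s => Rabs (Im (g s) - Im (g t)) < / 2))
      by exact (c2 _ (hball _)).
    generalize (filter_and _ _ d1 d2).
    apply filter_imp. intros s [b1 b2].
    assert (hsmall : Cmod (g s - g t) <= 1).
    { replace 1 with (2 * / 2) by lra.
      apply Cmod_le_components; left; [exact b1|exact b2]. }
    specialize (hK _ hsmall). unfold rem, q.
    replace (g t + (g s - g t))%C with (g s) in hK by ring.
    rewrite Cmod2_alt in hK. exact hK. }
  assert (hq0 : q t = 0) by (unfold q; ring).
  assert (hr0 : rem t = RtoC 0) by (unfold rem; ring).
  assert (hq : is_derive q t 0).
  { apply (is_derive_square_dist (fun s => Re (g s)) (fun s => Im (g s)) t _ _ K hg1 hg2). }
  split.
  - assert (h : is_derive (fun s => Re (rem s)) t 0).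
    { apply is_derive_0_squeeze with q; [rewrite hr0; reflexivity|exact hq0| |exact hq].
      revert hloc. apply filter_imp. intros s hs.
      apply Rle_trans with (2 := hs). apply re_le_Cmod. }
    apply is_derive_ext with (fun s => Re (rem s) + (Re (entire_sum a (g t))
       + ((Re (g s) - Re (g t)) * Re D + (Im (g s) - Im (g t)) * (- Im D)))).
    + intros s. unfold rem, Re, Im; simpl. ring.
    + replace (Re (D * l)%C) with (Re l * Re D + Im l * (- Im D))
        by (unfold Re, Im; simpl; ring).
      exact (is_derive_affine_plus_flat _ _ _ _ _ _ _ _ _ _ _ h hg1 hg2).
  - assert (h : is_derive (fun s => Im (rem s)) t 0).
    { apply is_derive_0_squeeze with q; [rewrite hr0; reflexivity|exact hq0| |exact hq].
      revert hloc. apply filter_imp. intros s hs.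
      apply Rle_trans with (2 := hs). apply im_le_Cmod. }
    apply is_derive_ext with (fun s => Im (rem s) + (Im (entire_sum a (g t))
       + ((Re (g s) - Re (g t)) * Im D + (Im (g s) - Im (g t)) * Re D))).
    + intros s. unfold rem, Re, Im; simpl. ring.
    + replace (Im (D * l)%C) with (Re l * Im D + Im l * Re D)
        by (unfold Re, Im; simpl; ring).
      exact (is_derive_affine_plus_flat _ _ _ _ _ _ _ _ _ _ _ h hg1 hg2).
Qed.

Lemma CSeries_0 : CSeries (fun _ => RtoC 0) = RtoC 0.
Proof.
  unfold CSeries, RtoC; simpl.
  rewrite (Series_ext _ (fun _ => 0 * 0)) by (intros; ring).
  rewrite Series_scal_l. f_equal; ring.
Qed.

Lemma entire_sum_0 (a : nat -> R) :
  CV_radius a = p_infty -> entire_sum a (RtoC 0) = RtoC (a O).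
Proof.
  intros ha. unfold entire_sum.
  rewrite CSeries_incr_1 by (apply entire_abs_summable; exact ha).
  rewrite (CSeries_ext _ (fun _ => RtoC 0)); [rewrite CSeries_0; simpl; ring|].
  intros n. simpl. ring.
Qed.

Lemma entire_sum_RtoC (a : nat -> R) (x : R) : entire_sum a (RtoC x) = RtoC (PSeries a x).
Proof.
  unfold entire_sum, PSeries.
  rewrite (CSeries_ext _ (fun n => RtoC (a n * x ^ n))).
  - unfold CSeries, RtoC; simpl. f_equal.
    rewrite (Series_ext _ (fun _ => 0 * 0)) by (intros; ring).
    rewrite Series_scal_l. ring.
  - intros n. rewrite RtoC_mult, RtoC_pow. reflexivity.
Qed.

Lemma entire_sum_incr_1 (a : nat -> R) (w : C) :
  CV_radius a = p_infty -> (w * entire_sum a w)%C = entire_sum (PS_incr_1 a) w.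
Proof.
  intros ha. unfold entire_sum.
  rewrite <- CSeries_scal by (apply entire_abs_summable; exact ha).
  rewrite (CSeries_incr_1 (fun n => RtoC (PS_incr_1 a n) * w ^ n)%C)
    by (apply entire_abs_summable; rewrite CV_radius_incr_1; exact ha).
  simpl. unfold zero; simpl. rewrite !Cmult_0_l, Cplus_0_l.
  apply CSeries_ext. intros n. ring.
Qed.

(** * The Bessel-Clifford function *)

Definition bessel_coef (nu : R) (n : nat) : R := / (INR (fact n) * Gamma (nu + INR n + 1)).

Lemma bessel_coef_pos (nu : R) (n : nat) : -1 < nu -> 0 < bessel_coef nu n.
Proof.
  intros hnu. apply Rinv_0_lt_compat, Rmult_lt_0_compat.
  - apply INR_fact_lt_0.
  - apply Gamma_pos. generalize (pos_INR n). lra.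
Qed.

Lemma bessel_coef_succ (nu : R) (n : nat) :
  -1 < nu -> INR (S n) * (nu + INR (S n)) * bessel_coef nu (S n) = bessel_coef nu n.
Proof.
  intros hnu. assert (hn := pos_INR n).
  unfold bessel_coef. rewrite fact_simpl, mult_INR, S_INR.
  replace (nu + (INR n + 1) + 1) with (nu + INR n + 1 + 1) by ring.
  rewrite Gamma_succ by lra.
  assert (h1 := INR_fact_lt_0 n). assert (h2 := Gamma_pos (nu + INR n + 1) ltac:(lra)).
  field. repeat split; lra.
Qed.

Lemma bessel_coef_entire (nu : R) : -1 < nu -> CV_radius (bessel_coef nu) = p_infty.
Proof.
  intros hnu. apply CV_radius_infinite_DAlembert.
  - intros n. apply Rgt_not_eq, bessel_coef_pos. exact hnu.
  - apply is_lim_seq_le_le with (fun _ => 0) (fun n => / (nu + 1) * / INR (S n)).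
    + intros n. split; [apply Rabs_pos|].
      assert (h1 := bessel_coef_pos nu (S n) hnu). assert (hn := pos_INR n).
      rewrite <- (bessel_coef_succ nu n hnu). rewrite S_INR.
      replace (bessel_coef nu (S n) / ((INR n + 1) * (nu + (INR n + 1)) * bessel_coef nu (S n)))
        with (/ (nu + (INR n + 1)) * / (INR n + 1)) by (field; lra).
      rewrite Rabs_pos_eq.
      * apply Rmult_le_compat_r; [left; apply Rinv_0_lt_compat; lra|].
        apply Rinv_le_contravar; lra.
      * left. apply Rmult_lt_0_compat; apply Rinv_0_lt_compat; lra.
    + apply is_lim_seq_const.
    + replace (Finite 0) with (Rbar_mult (/ (nu + 1)) 0)
        by (simpl; rewrite Rmult_0_r; reflexivity).
      apply is_lim_seq_scal_l.
      apply (is_lim_seq_incr_1 (fun n => / INR n)).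
      replace (Finite 0) with (Rbar_inv p_infty) by reflexivity.
      apply is_lim_seq_inv; [apply is_lim_seq_INR|discriminate].
Qed.

(** The Bessel-Clifford function, that is [0F1 (; nu + 1; w) / Gamma (nu + 1)], followed
    by its first two derivatives. *)
Definition clifford (nu : R) : C -> C := entire_sum (bessel_coef nu).
Definition clifford_d1 (nu : R) : C -> C := entire_sum (PS_derive (bessel_coef nu)).
Definition clifford_d2 (nu : R) : C -> C := entire_sum (PS_derive (PS_derive (bessel_coef nu))).

(** Coefficientwise this is [n (nu + n) c_n = c_(n-1)]. *)
Lemma clifford_ode (nu : R) (w : C) :
  -1 < nu -> (w * clifford_d2 nu w + RtoC (nu + 1) * clifford_d1 nu w = clifford nu w)%C.
Proof.
  intros hnu. assert (h0 := bessel_coef_entire nu hnu).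
  assert (h1 := entire_derive _ h0). assert (h2 := entire_derive _ h1).
  unfold clifford_d2. rewrite entire_sum_incr_1 by exact h2.
  unfold clifford, clifford_d1, entire_sum.
  rewrite <- CSeries_scal by (apply entire_abs_summable; exact h1).
  rewrite <- CSeries_plus.
  - apply CSeries_ext. intros n. rewrite <- (bessel_coef_succ nu n hnu).
    replace (PS_incr_1 (PS_derive (PS_derive (bessel_coef nu))) n)
      with (INR n * PS_derive (bessel_coef nu) n)
      by (destruct n; simpl; [unfold zero; simpl; ring|reflexivity]).
    unfold PS_derive. rewrite S_INR.
    rewrite !RtoC_mult, !RtoC_plus. ring.
  - apply entire_abs_summable. rewrite CV_radius_incr_1. exact h2.
  - apply abs_summable_le with
      (fun n => Cmod (RtoC (nu + 1)) * Cmod (RtoC (PS_derive (bessel_coef nu) n) * w ^ n)).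
    + intros n. rewrite Cmod_mult. lra.
    + apply (ex_series_scal (V := R_NormedModule)). apply entire_abs_summable. exact h1.
Qed.

(** * The energy argument: zeros are real *)

Lemma nondecreasing_of_derive (G dG : R -> R) :
  (forall s, 0 < s <= 1 -> is_derive G s (dG s)) ->
  (forall s, 0 < s <= 1 -> 0 <= dG s) ->
  forall s t, 0 < s -> s <= t -> t <= 1 -> G s <= G t.
Proof.
  intros hG hpos s t hs hst ht.
  destruct (MVT_gen G s t dG) as [c [hc heq]].
  - intros x hx. apply hG. rewrite Rmin_left, Rmax_right in hx by lra. lra.
  - intros x hx. rewrite Rmin_left, Rmax_right in hx by lra.
    apply derivable_continuous_pt. exists (dG x). apply is_derive_Reals, hG. lra.
  - rewrite Rmin_left, Rmax_right in hc by lra.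
    assert (h := hpos c ltac:(lra)). nra.
Qed.

Lemma continuous_eps (f : R -> R) (x e : R) :
  continuous f x -> 0 < e ->
  exists d, 0 < d /\ forall y, Rabs (y - x) < d -> Rabs (f y - f x) < e.
Proof.
  intros hf he. destruct (hf (fun v => Rabs (v - f x) < e)) as [d hd].
  - exists (mkposreal e he). intros y hy; exact hy.
  - exists d. split; [apply cond_pos|]. intros y hy. apply hd. exact hy.
Qed.

(** The flux [s^(nu+1) B s] is nondecreasing, vanishes at [1], and tends to [0] at [0]
    because [nu + 1 > 0].  So it is identically [0], and so is its derivative.
    Monotonicity replaces an integration over the segment, which would be improper at
    [0] when [nu < 0]. *)
Lemma weighted_flux_vanishes (nu : R) (B Q : R -> R) :
  -1 < nu ->
  (forall s, 0 < s <= 1 ->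
     is_derive (fun s => Rpower s (nu + 1) * B s) s (Rpower s nu * Q s)) ->
  (forall s, 0 < s <= 1 -> 0 <= Q s) ->
  B 1 = 0 -> continuous B 0 -> continuous Q 0 -> Q 0 = 0.
Proof.
  intros hnu hder hQ hB1 hBc hQc.
  set (G := fun s => Rpower s (nu + 1) * B s) in *.
  assert (hmono := nondecreasing_of_derive G _ hder
    (fun s hs => Rmult_le_pos _ _ (Rlt_le _ _ (exp_pos _)) (hQ s hs))).
  assert (hG1 : G 1 = 0) by (unfold G; rewrite hB1; ring).
  assert (hG0 : forall s, 0 < s <= 1 -> G s = 0).
  { intros s hs. apply Rle_antisym.
    - rewrite <- hG1. apply hmono; lra.
    - apply Rnot_lt_le. intros hneg.
      destruct (continuous_eps B 0 1 hBc Rlt_0_1) as [d1 [hd1 hB]].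
      set (M := Rabs (B 0) + 1).
      assert (hM : 0 < M) by (unfold M; generalize (Rabs_pos (B 0)); lra).
      destruct (Rpower_small_near_0 (nu + 1) (- G s / M)) as [d2 [hd2 hpow]].
      { lra. } { apply Rdiv_lt_0_compat; lra. }
      set (t := Rmin s (Rmin d1 d2) / 2).
      assert (hmin : 0 < Rmin s (Rmin d1 d2)) by (repeat apply Rmin_pos; lra).
      assert (h1 := Rmin_l s (Rmin d1 d2)). assert (h2 := Rmin_r s (Rmin d1 d2)).
      assert (h3 := Rmin_l d1 d2). assert (h4 := Rmin_r d1 d2).
      assert (ht : 0 < t) by (unfold t; lra).
      assert (hts : t < s /\ t < d1 /\ t < d2) by (unfold t; lra).
      assert (hGt := hmono t s ht ltac:(lra) ltac:(lra)).
      assert (hp := hpow t ltac:(lra)).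
      assert (hBt : - M <= B t).
      { assert (hb := hB t ltac:(rewrite Rminus_0_r, Rabs_pos_eq; lra)).
        apply Rabs_def2 in hb. unfold M.
        generalize (Rle_abs (- B 0)). rewrite Rabs_Ropp. lra. }
      assert (hp0 : 0 < Rpower t (nu + 1)) by apply exp_pos.
      assert (hlow : - (Rpower t (nu + 1) * M) <= G t) by (unfold G; nra).
      apply (Rmult_lt_compat_r M) in hp; [|exact hM].
      replace (- G s / M * M) with (- G s) in hp by (field; lra). lra. }
  assert (hQ0 : forall s, 0 < s < 1 -> Q s = 0).
  { intros s hs.
    assert (hd0 : is_derive G s 0).
    { apply (is_derive_ext_loc (fun _ => 0)).
      - assert (hd : 0 < Rmin s (1 - s)) by (apply Rmin_pos; lra).
        exists (mkposreal _ hd). intros y hy. symmetry. apply hG0.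
        change (Rabs (y - s) < Rmin s (1 - s)) in hy.
        apply Rabs_def2 in hy.
        generalize (Rmin_l s (1 - s)) (Rmin_r s (1 - s)). lra.
      - apply (is_derive_const (V := R_NormedModule)). }
    assert (hd1 := hder s ltac:(lra)).
    assert (hprod : Rpower s nu * Q s = 0).
    { transitivity (Derive G s); [symmetry|]; apply is_derive_unique; assumption. }
    apply Rmult_integral in hprod. destruct hprod as [h|h]; [|exact h].
    exfalso. generalize (exp_pos (nu * ln s)). unfold Rpower in h. lra. }
  apply Rabs_eq_0. apply Rle_antisym; [|apply Rabs_pos].
  apply Rnot_lt_le. intros hne.
  destruct (continuous_eps Q 0 _ hQc hne) as [d [hd hQd]].
  set (t := Rmin d 1 / 2).
  assert (hmin : 0 < Rmin d 1) by (apply Rmin_pos; lra).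
  assert (h1 := Rmin_l d 1). assert (h2 := Rmin_r d 1).
  specialize (hQd t ltac:(rewrite Rminus_0_r, Rabs_pos_eq; unfold t; lra)).
  rewrite (hQ0 t) in hQd by (unfold t; lra).
  rewrite Rminus_0_l, Rabs_Ropp in hQd. lra.
Qed.

Lemma Re_lt_Cmod (z : C) : ~ (Im z = 0 /\ 0 <= Re z) -> Re z < Cmod z.
Proof.
  intros hz. destruct (Rle_lt_or_eq_dec (Re z) (Cmod z)) as [h|h]; [|exact h|].
  - apply Rle_trans with (1 := Rle_abs _). apply re_le_Cmod.
  - exfalso. apply hz. assert (h2 := Cmod2_alt z). rewrite <- h in h2. split.
    + nra.
    + rewrite h. apply Cmod_ge_0.
Qed.

Lemma ex_derive_energy (k m : R) (a b c d : R -> R) (t : R) :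
  ex_derive a t -> ex_derive b t -> ex_derive c t -> ex_derive d t ->
  ex_derive (fun s => k * (m * (a s ^ 2 + b s ^ 2) + (c s ^ 2 + d s ^ 2))) t.
Proof. intros ha hb hc hd. auto_derive. repeat split; assumption. Qed.

(** Green's identity for the plate operator [D (D u) = lam u], with [v = D u] and
    [D y = s y'' + (nu + 1) y'].  The flux [H = v' u^* - v u'^*] satisfies
    [s H' + (nu + 1) H = lam |u|^2 - |v|^2].  After multiplication by
    [al = lam^* - |lam|] the right-hand side has real part
    [(|lam| - Re lam) (|lam| |u|^2 + |v|^2)], which is positive definite in [(u, v)]
    unless [lam] is a nonnegative real number; then [weighted_flux_vanishes]
    applies. *)
Lemma plate_energy (nu : R) (lam : C) (u v p q P Q : R -> C) :
  -1 < nu ->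
  (forall s, curve_derive u s (p s)) -> (forall s, curve_derive p s (P s)) ->
  (forall s, curve_derive v s (q s)) -> (forall s, curve_derive q s (Q s)) ->
  (forall s, RtoC s * P s + RtoC (nu + 1) * p s = v s)%C ->
  (forall s, RtoC s * Q s + RtoC (nu + 1) * q s = lam * u s)%C ->
  (q 1 * Cconj (u 1) = v 1 * Cconj (p 1))%C ->
  (Im lam = 0 /\ 0 <= Re lam) \/ (u 0 = RtoC 0 /\ v 0 = RtoC 0).
Proof.
  intros hnu hu hp hv hq hLu hLv hbd.
  destruct (Classical_Prop.classic (Im lam = 0 /\ 0 <= Re lam)) as [h|hlam];
    [left; exact h|right].
  apply Re_lt_Cmod in hlam.
  set (m := Cmod lam) in *. set (k := m - Re lam).
  assert (hm : - Re lam <= m).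
  { apply Rle_trans with (1 := Rle_abs _). rewrite Rabs_Ropp. apply re_le_Cmod. }
  assert (hm2 : m ^ 2 = Re lam ^ 2 + Im lam ^ 2) by apply Cmod2_alt.
  set (al := (Cconj lam - RtoC m)%C).
  set (H := fun s => (q s * Cconj (u s) - v s * Cconj (p s))%C).
  set (dH := fun s => (Q s * Cconj (u s) - v s * Cconj (P s))%C).
  assert (hH : forall s, curve_derive H s (dH s)).
  { intros s. eapply curve_derive_eq.
    - apply curve_derive_minus.
      + exact (curve_derive_mult _ _ _ _ _ (hq s) (curve_derive_conj _ _ _ (hu s))).
      + exact (curve_derive_mult _ _ _ _ _ (hv s) (curve_derive_conj _ _ _ (hp s))).
    - unfold dH. ring. }
  set (B := fun s => Re (al * H s)).
  set (N := fun w : C => Re w ^ 2 + Im w ^ 2).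
  set (W := fun s => k * (m * N (u s) + N (v s))).
  assert (hid : forall s, s * Re (al * dH s) + (nu + 1) * B s = W s).
  { intros s. unfold B, W.
    transitivity (Re (al * (lam * u s * Cconj (u s) - v s * Cconj (v s)))).
    - assert (hconj : Cconj (v s) = (RtoC s * Cconj (P s) + RtoC (nu + 1) * Cconj (p s))%C).
      { rewrite <- hLu. unfold Cconj, Cplus, Cmult; simpl. f_equal; ring. }
      rewrite hconj, <- hLv.
      replace (al * ((RtoC s * Q s + RtoC (nu + 1) * q s) * Cconj (u s)
          - v s * (RtoC s * Cconj (P s) + RtoC (nu + 1) * Cconj (p s))))%C
        with (RtoC s * (al * dH s) + RtoC (nu + 1) * (al * H s))%C
        by (unfold dH, H; ring).
      generalize (al * dH s)%C (al * H s)%C. intros x y. unfold Re; simpl. ring.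
    - transitivity ((m ^ 2 - Re lam * m) * N (u s) + (m - Re lam) * N (v s)).
      + rewrite hm2. clearbody m. unfold al, N. destruct lam as [l1 l2].
        destruct (u s) as [a1 a2]. destruct (v s) as [c1 c2]. unfold Re, Im; simpl. ring.
      + unfold k. ring. }
  assert (hW0 : W 0 = 0).
  { apply (weighted_flux_vanishes nu B W hnu).
    - intros s hs.
      assert (hB : is_derive B s (Re (al * dH s)))
        by apply (curve_derive_scal al H s (dH s) (hH s)).
      assert (hR := is_derive_Rpower (nu + 1) s ltac:(lra)).
      evar_last.
      + apply (is_derive_mult (fun s => Rpower s (nu + 1)) B s _ _ hR hB).
        intros; apply Rmult_comm.
      + transitivity ((nu + 1) * Rpower s (nu + 1 - 1) * B s
                        + Rpower s (nu + 1) * Re (al * dH s)); [reflexivity|].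
        rewrite <- hid. replace (nu + 1 - 1) with nu by ring.
        rewrite Rpower_plus, Rpower_1 by lra. ring.
    - intros s _. unfold W, N. apply Rmult_le_pos; [unfold k; lra|].
      assert (0 <= m) by apply Cmod_ge_0.
      generalize (pow2_ge_0 (Re (u s))) (pow2_ge_0 (Im (u s))) (pow2_ge_0 (Re (v s)))
        (pow2_ge_0 (Im (v s))). nra.
    - unfold B, H. rewrite hbd. unfold Re; simpl. ring.
    - apply (curve_derive_continuous (fun s => al * H s)%C 0 (al * dH 0)%C).
      apply curve_derive_scal. apply hH.
    - destruct (hu 0) as [u1 u2]. destruct (hv 0) as [v1 v2].
      apply (ex_derive_continuous W).
      exact (ex_derive_energy _ _ _ _ _ _ _ (ex_intro _ _ u1) (ex_intro _ _ u2)
               (ex_intro _ _ v1) (ex_intro _ _ v2)). }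
  assert (hk : 0 < k) by (unfold k; lra). assert (hm0 : 0 < m) by lra.
  unfold W in hW0. apply Rmult_integral in hW0. destruct hW0 as [h|h]; [lra|].
  unfold N in h.
  assert (a1 := pow2_ge_0 (Re (u 0))). assert (a2 := pow2_ge_0 (Im (u 0))).
  assert (a3 := pow2_ge_0 (Re (v 0))). assert (a4 := pow2_ge_0 (Im (v 0))).
  assert (b1 : Re (u 0) ^ 2 = 0) by nra. assert (b2 : Im (u 0) ^ 2 = 0) by nra.
  assert (b3 : Re (v 0) ^ 2 = 0) by nra. assert (b4 : Im (v 0) ^ 2 = 0) by nra.
  split; apply injective_projections; simpl; unfold Re, Im in *; nra.
Qed.

(** [plate_energy] for [u s = al f (z s) + be f (- z s)], where [lam = z^2].  The
    second hypothesis at [s = 1] is either [u' = 0] (clamped edge) or [D u = 0]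
    (hinged edge); with [u = 0] each of them makes the flux vanish.  Since [f 0]
    is nonzero, [u 0 = v 0 = 0] means [al + be = al - be = 0]. *)
Lemma plate_eigenvalue (nu : R) (z al be : C) :
  -1 < nu -> z <> RtoC 0 ->
  (al * clifford nu z + be * clifford nu (- z) = 0)%C ->
  (al * clifford_d1 nu z - be * clifford_d1 nu (- z) = 0 \/ al * clifford nu z - be * clifford nu (- z) = 0)%C ->
  (al = 0 /\ be = 0)%C \/ Im z = 0.
Proof.
  intros hnu hz hu1 hpv.
  assert (h0 := bessel_coef_entire nu hnu).
  assert (h1 := entire_derive _ h0).
  set (w := fun s => (z * RtoC s)%C). set (w' := fun s => (- z * RtoC s)%C).
  assert (hw : forall s, curve_derive w s z) by (intros s; apply curve_derive_ray).
  assert (hw' : forall s, curve_derive w' s (- z)) by (intros s; apply curve_derive_ray).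
  set (u := fun s => (al * clifford nu (w s) + be * clifford nu (w' s))%C).
  set (v := fun s => (z * (al * clifford nu (w s) - be * clifford nu (w' s)))%C).
  set (p := fun s => (z * (al * clifford_d1 nu (w s) - be * clifford_d1 nu (w' s)))%C).
  set (q := fun s => (z * (z * (al * clifford_d1 nu (w s) + be * clifford_d1 nu (w' s))))%C).
  set (P := fun s => (z * (z * (al * clifford_d2 nu (w s) + be * clifford_d2 nu (w' s))))%C).
  set (Q := fun s => (z * (z * (z * (al * clifford_d2 nu (w s) - be * clifford_d2 nu (w' s)))))%C).
  assert (d0 : forall s, curve_derive (fun s => clifford nu (w s)) s (clifford_d1 nu (w s) * z))
    by (intros s; apply entire_curve_derive; [exact h0|apply hw]).
  assert (d0' : forall s, curve_derive (fun s => clifford nu (w' s)) s (clifford_d1 nu (w' s) * - z))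
    by (intros s; apply entire_curve_derive; [exact h0|apply hw']).
  assert (d1 : forall s, curve_derive (fun s => clifford_d1 nu (w s)) s (clifford_d2 nu (w s) * z))
    by (intros s; apply entire_curve_derive; [exact h1|apply hw]).
  assert (d1' : forall s, curve_derive (fun s => clifford_d1 nu (w' s)) s (clifford_d2 nu (w' s) * - z))
    by (intros s; apply entire_curve_derive; [exact h1|apply hw']).
  destruct (plate_energy nu (z * z) u v p q P Q) as [[hi hr]|[hu0 hv0]].
  - exact hnu.
  - intros s. eapply curve_derive_eq.
    + apply curve_derive_plus; apply curve_derive_scal; [apply d0|apply d0'].
    + unfold p. ring.
  - intros s. eapply curve_derive_eq.
    + apply curve_derive_scal, curve_derive_minus; apply curve_derive_scal; [apply d1|apply d1'].
    + unfold P. ring.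
  - intros s. eapply curve_derive_eq.
    + apply curve_derive_scal, curve_derive_minus; apply curve_derive_scal; [apply d0|apply d0'].
    + unfold q. ring.
  - intros s. eapply curve_derive_eq.
    + apply curve_derive_scal, curve_derive_scal, curve_derive_plus;
        apply curve_derive_scal; [apply d1|apply d1'].
    + unfold Q. ring.
  - intros s. unfold v. rewrite <- (clifford_ode nu (w s) hnu), <- (clifford_ode nu (w' s) hnu).
    unfold P, p, w, w'. ring.
  - intros s. unfold u. rewrite <- (clifford_ode nu (w s) hnu), <- (clifford_ode nu (w' s) hnu).
    unfold Q, q, w, w'. ring.
  - assert (hw1 : w 1 = z) by (unfold w; ring).
    assert (hw1' : w' 1 = (- z)%C) by (unfold w'; ring).
    assert (hu1' : u 1 = RtoC 0) by (unfold u; rewrite hw1, hw1'; exact hu1).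
    assert (hc0 : Cconj (RtoC 0) = RtoC 0) by (unfold Cconj, RtoC; simpl; f_equal; ring).
    rewrite hu1', hc0, Cmult_0_r.
    destruct hpv as [hp|hv].
    + assert (hp' : p 1 = RtoC 0) by (unfold p; rewrite hw1, hw1', hp; ring).
      rewrite hp', hc0. ring.
    + assert (hv' : v 1 = RtoC 0) by (unfold v; rewrite hw1, hw1', hv; ring).
      rewrite hv'. ring.
  - right. destruct z as [x y]. unfold Re, Im in *; simpl in *.
    assert (hxy : x * y = 0) by lra.
    apply Rmult_integral in hxy. destruct hxy as [-> | ->]; [|reflexivity].
    assert (y * y = 0) by nra. nra.
  - left.
    assert (hc : RtoC (bessel_coef nu 0) <> RtoC 0).
    { intros h. apply RtoC_inj in h. generalize (bessel_coef_pos nu 0 hnu). lra. }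
    assert (e0 : forall s : C, (s * RtoC 0)%C = RtoC 0) by (intros; ring).
    unfold u, v, w, w', clifford in hu0, hv0. rewrite !e0, entire_sum_0 in hu0, hv0 by exact h0.
    assert (s1 : (al + be)%C = RtoC 0).
    { replace (al + be)%C with ((al * RtoC (bessel_coef nu 0) + be * RtoC (bessel_coef nu 0))
        / RtoC (bessel_coef nu 0))%C by (field; exact hc).
      rewrite hu0. field. exact hc. }
    assert (s2 : (al - be)%C = RtoC 0).
    { replace (al - be)%C with (z * (al * RtoC (bessel_coef nu 0) - be * RtoC (bessel_coef nu 0))
        / (z * RtoC (bessel_coef nu 0)))%C by (field; split; assumption).
      rewrite hv0. field. split; assumption. }
    assert (t1 : al = RtoC 0).
    { replace al with (((al + be) + (al - be)) / RtoC 2)%C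
        by (field; intros h; apply RtoC_inj in h; lra).
      rewrite s1, s2. field. }
    split; [exact t1|]. rewrite t1 in s1. rewrite <- s1. ring.
Qed.

Definition clifford_cross (nu : R) (w : C) : C :=
  (clifford nu (- w) * clifford_d1 nu w + clifford_d1 nu (- w) * clifford nu w)%C.

(** At a zero [w] of [f], the function [f (w s)] is a hinged mode. *)
Lemma clifford_zero_real (nu : R) (w : C) : -1 < nu -> clifford nu w = RtoC 0 -> Im w = 0.
Proof.
  intros hnu hw.
  destruct (Classical_Prop.classic (w = RtoC 0)) as [->|hne]; [reflexivity|].
  destruct (plate_eigenvalue nu w (RtoC 1) (RtoC 0) hnu hne) as [[h _]|h]; [| | |exact h].
  - rewrite hw. ring.
  - right. rewrite hw. ring.
  - apply RtoC_inj in h. lra.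
Qed.

(** At such a zero, [f (- w) f (w s) - f w f (- w s)] is a clamped mode.  It is not
    trivial unless [f w = 0], a case already settled by the hinged mode. *)
Lemma clifford_cross_zero_real (nu : R) (w : C) : -1 < nu -> clifford_cross nu w = RtoC 0 -> Im w = 0.
Proof.
  intros hnu hw.
  destruct (Classical_Prop.classic (w = RtoC 0)) as [->|hne]; [reflexivity|].
  destruct (plate_eigenvalue nu w (clifford nu (- w)) (- clifford nu w) hnu hne) as [[_ h]|h];
    [| | |exact h].
  - ring.
  - left. rewrite <- hw. unfold clifford_cross. ring.
  - apply (clifford_zero_real nu w hnu). replace (clifford nu w) with (- - clifford nu w)%C by ring.
    rewrite h. ring.
Qed.

(** * Oscillation: zeros are unbounded *)

(** Comparison with [S x = sin ((x - a) / 2)], which solves [S'' = - S / 4] and is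
    nonnegative on the interval.  If [y] kept the sign of [y a], then
    [y a * (y' S - y S')] would be nonincreasing, yet it is negative at [a] and
    positive at [a + 2 PI]. *)
Lemma sturm_zero (a : R) (y dy r : R -> R) :
  (forall x, a <= x <= a + 2 * PI -> is_derive y x (dy x)) ->
  (forall x, a <= x <= a + 2 * PI -> is_derive dy x (r x * y x)) ->
  (forall x, a <= x <= a + 2 * PI -> r x <= - / 4) ->
  exists x, a <= x <= a + 2 * PI /\ y x = 0.
Proof.
  intros hy hdy hr. apply Classical_Prop.NNPP. intros hno.
  assert (hpi := PI_RGT_0).
  assert (hne : forall x, a <= x <= a + 2 * PI -> y x <> 0)
    by (intros x hx h0; apply hno; exists x; split; assumption).
  assert (hya := hne a ltac:(lra)).
  assert (hsign : forall x, a <= x <= a + 2 * PI -> 0 < y a * y x).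
  { intros x hx. apply Rnot_le_lt. intros hle.
    assert (hlt : y a * y x < 0).
    { destruct hle as [h|h]; [exact h|]. exfalso.
      apply Rmult_integral in h. destruct h as [h|h]; [exact (hya h)|exact (hne x hx h)]. }
    assert (hax : a < x).
    { destruct (Rle_lt_or_eq_dec a x) as [h|h]; [lra|exact h|]. subst x. nra. }
    destruct (IVT_interv (fun t => - (y a * y t)) a x) as [z [hz hz0]].
    - intros t ht. apply continuity_pt_opp, continuity_pt_scal.
      apply derivable_continuous_pt. exists (dy t). apply is_derive_Reals, hy. lra.
    - exact hax.
    - nra.
    - lra.
    - apply (hne z ltac:(lra)). apply Rmult_eq_reg_l with (y a); lra. }
  set (S := fun x => sin ((x - a) / 2)). set (Co := fun x => cos ((x - a) / 2)).
  set (W := fun x => y a * (dy x * S x - y x * (Co x / 2))).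
  set (dW := fun x => y a * y x * (r x + / 4) * S x).
  assert (hW : forall x, a <= x <= a + 2 * PI -> is_derive W x (dW x)).
  { intros x hx. assert (d1 := hy x hx). assert (d2 := hdy x hx).
    unfold W, S, Co. auto_derive.
    - repeat split; eexists; eassumption.
    - replace (Derive (fun x => y x) x) with (dy x) by (symmetry; exact (is_derive_unique _ _ _ d1)).
      replace (Derive (fun x => dy x) x) with (r x * y x)
        by (symmetry; exact (is_derive_unique _ _ _ d2)).
      unfold dW, S. unfold Rminus, Rdiv. field. }
  destruct (MVT_gen W a (a + 2 * PI) dW) as [c [hc heq]].
  - intros x hx. rewrite Rmin_left, Rmax_right in hx by lra. apply hW; lra.
  - intros x hx. rewrite Rmin_left, Rmax_right in hx by lra.
    apply derivable_continuous_pt. exists (dW x). apply is_derive_Reals, hW. lra.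
  - rewrite Rmin_left, Rmax_right in hc by lra.
    assert (hWa : W a = - (y a * y a) / 2).
    { unfold W, S, Co. replace ((a - a) / 2) with 0 by field. rewrite sin_0, cos_0. field. }
    assert (hWb : W (a + 2 * PI) = y a * y (a + 2 * PI) / 2).
    { unfold W, S, Co. replace ((a + 2 * PI - a) / 2) with PI by field.
      rewrite sin_PI, cos_PI. field. }
    assert (h1 := hsign a ltac:(lra)). assert (h2 := hsign (a + 2 * PI) ltac:(lra)).
    assert (h3 : dW c <= 0).
    { unfold dW. assert (hs : 0 <= S c) by (apply sin_ge_0; lra).
      assert (h4 := hsign c hc). assert (h5 := hr c hc).
      assert (h6 : 0 <= y a * y c * S c) by (apply Rmult_le_pos; lra). nra. }
    assert (h7 : dW c * (a + 2 * PI - a) <= 0) by nra.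
    lra.
Qed.

(** The classical normal form: [y x = x^(nu + 1/2) F0 (- x^2 / 4)], which is
    [sqrt x * J x] up to a constant when [F0] is the Bessel-Clifford function, satisfies
    [y'' = ((nu^2 - 1/4) / x^2 - 1) y], and the bracket is at most [- 1/4] for large
    [x]. *)
Lemma negative_zeros_unbounded (nu : R) (F0 F1 F2 : R -> R) (M : R) :
  (forall s, is_derive F0 s (F1 s)) -> (forall s, is_derive F1 s (F2 s)) ->
  (forall s, s * F2 s + (nu + 1) * F1 s = F0 s) ->
  exists s, M < s /\ F0 (- s) = 0.
Proof.
  intros derive0 derive1 ode.
  set (a := nu + / 2).
  set (y := fun x => Rpower x a * F0 (- (x * x / 4))).
  set (dy := fun x => Rpower x a * (a / x * F0 (- (x * x / 4)) - x / 2 * F1 (- (x * x / 4)))).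
  set (r := fun x => (a * a - a) / (x * x) - 1).
  (* Beyond A the comparison bound holds, by the first summand, and x^2 / 4 exceeds M,
     by the second. *)
  set (A := 2 * (a * a + 1) + 2 * (Rabs M + 1)).
  assert (hM := Rle_abs M). assert (hM0 := Rabs_pos M).
  assert (ha2 : 0 <= a * a) by nra.
  assert (hpi := PI_RGT_0).
  assert (hF0 : forall x, is_derive (fun x => F0 (- (x * x / 4))) x
                            (- (x / 2) * F1 (- (x * x / 4)))).
  { intros x. evar_last.
    - apply (is_derive_comp F0 (fun x => - (x * x / 4)) x); [apply derive0|].
      auto_derive; [exact I|reflexivity].
    - unfold scal; simpl; unfold mult; simpl. field. }
  assert (hF1 : forall x, is_derive (fun x => F1 (- (x * x / 4))) x
                            (- (x / 2) * F2 (- (x * x / 4)))).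
  { intros x. evar_last.
    - apply (is_derive_comp F1 (fun x => - (x * x / 4)) x); [apply derive1|].
      auto_derive; [exact I|reflexivity].
    - unfold scal; simpl; unfold mult; simpl. field. }
  assert (hR : forall x, 0 < x -> is_derive (fun x => Rpower x a) x (a / x * Rpower x a)).
  { intros x hx. evar_last; [apply is_derive_Rpower; exact hx|].
    unfold Rminus. rewrite Rpower_plus, Rpower_Ropp, Rpower_1 by exact hx.
    unfold Rdiv. ring. }
  destruct (sturm_zero A y dy r) as [x [hx hx0]].
  - intros x hx. assert (hx' : 0 < x) by (unfold A in hx; lra).
    evar_last.
    + apply (is_derive_mult (fun x => Rpower x a) (fun x => F0 (- (x * x / 4))) x _ _
               (hR x hx') (hF0 x)).
      intros; apply Rmult_comm.
    + unfold plus, mult; simpl. unfold dy. field. lra.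
  - intros x hx. assert (hx' : 0 < x) by (unfold A in hx; lra).
    assert (hin : is_derive
      (fun x => a / x * F0 (- (x * x / 4)) - x / 2 * F1 (- (x * x / 4))) x
      (- a / (x * x) * F0 (- (x * x / 4)) + a / x * (- (x / 2) * F1 (- (x * x / 4)))
       - (/ 2 * F1 (- (x * x / 4)) + x / 2 * (- (x / 2) * F2 (- (x * x / 4)))))).
    { apply (is_derive_minus (fun x => a / x * F0 (- (x * x / 4)))
               (fun x => x / 2 * F1 (- (x * x / 4)))).
      - apply (is_derive_mult (fun x => a / x) (fun x => F0 (- (x * x / 4))));
          [|apply hF0|intros; apply Rmult_comm].
        auto_derive; [lra|field; lra].
      - apply (is_derive_mult (fun x => x / 2) (fun x => F1 (- (x * x / 4))));
          [|apply hF1|intros; apply Rmult_comm].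
        auto_derive; [exact I|field]. }
    evar_last.
    + apply (is_derive_mult (fun x => Rpower x a) (fun x => a / x * F0 (- (x * x / 4)) - x / 2 * F1 (- (x * x / 4)))
               x _ _ (hR x hx') hin).
      intros; apply Rmult_comm.
    + unfold plus, mult; simpl. unfold r, y.
      assert (h := ode (- (x * x / 4))). rewrite <- h. unfold a. field. lra.
  - intros x hx. unfold A in hx. assert (hx' : 0 < x) by lra. unfold r.
    assert (h : (a * a - a) / (x * x) <= 3 / 4); [|lra].
    apply Rmult_le_reg_r with (x * x); [nra|].
    replace ((a * a - a) / (x * x) * (x * x)) with (a * a - a) by (field; lra).
    assert (hxx : 4 * (a * a + 1) <= x * x).
    { apply Rle_trans with ((2 * (a * a + 1)) * (2 * (a * a + 1))); [nra|].
      apply Rmult_le_compat; lra. }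
    assert (0 <= (a + 1) * (a + 1)) by apply Rle_0_sqr. lra.
  - exists (x * x / 4). unfold A in hx. split.
    + nra.
    + apply Rmult_integral in hx0. destruct hx0 as [h|h]; [|exact h].
      exfalso. generalize (exp_pos (a * ln x)). unfold Rpower in h. lra.
Qed.

(** Rolle's theorem for [F0 (- s) / F0 s] between two of its zeros. *)
Lemma cross_product_zeros_unbounded (nu : R) (F0 F1 F2 : R -> R) (M : R) :
  (forall s, is_derive F0 s (F1 s)) -> (forall s, is_derive F1 s (F2 s)) ->
  (forall s, s * F2 s + (nu + 1) * F1 s = F0 s) ->
  (forall s, 0 < s -> 0 < F0 s) ->
  exists s, M < s /\ F0 (- s) * F1 s + F1 (- s) * F0 s = 0.
Proof.
  intros derive0 derive1 ode F0_pos.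
  destruct (negative_zeros_unbounded nu F0 F1 F2 (Rmax M 0) derive0 derive1 ode) as [s1 [h1 z1]].
  destruct (negative_zeros_unbounded nu F0 F1 F2 s1 derive0 derive1 ode) as [s2 [h2 z2]].
  assert (hM := Rmax_l M 0). assert (h0 := Rmax_r M 0).
  set (h := fun s => F0 (- s) / F0 s).
  set (dh := fun s => - (F0 (- s) * F1 s + F1 (- s) * F0 s) / (F0 s * F0 s)).
  assert (hd : forall s, 0 < s -> is_derive h s (dh s)).
  { intros s hs. assert (hp := F0_pos s hs).
    assert (d1 := derive0 s). assert (d2 := derive0 (- s)).
    unfold h. auto_derive.
    - repeat split; try (eexists; eassumption). lra.
    - replace (Derive (fun x => F0 x) s) with (F1 s) by (symmetry; exact (is_derive_unique _ _ _ d1)).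
      replace (Derive (fun x => F0 x) (- s)) with (F1 (- s))
        by (symmetry; exact (is_derive_unique _ _ _ d2)).
      unfold dh. field. lra. }
  destruct (MVT_gen h s1 s2 dh) as [c [hc heq]].
  - intros s hs. rewrite Rmin_left, Rmax_right in hs by lra. apply hd. lra.
  - intros s hs. rewrite Rmin_left, Rmax_right in hs by lra.
    apply derivable_continuous_pt. exists (dh s). apply is_derive_Reals, hd. lra.
  - rewrite Rmin_left, Rmax_right in hc by lra.
    assert (hh1 : h s1 = 0) by (unfold h; rewrite z1; unfold Rdiv; ring).
    assert (hh2 : h s2 = 0) by (unfold h; rewrite z2; unfold Rdiv; ring).
    rewrite hh1, hh2, Rminus_0_r in heq. symmetry in heq.
    apply Rmult_integral in heq. destruct heq as [heq|heq]; [|lra].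
    exists c. split; [lra|]. assert (hp := F0_pos c ltac:(lra)).
    apply Rmult_integral in heq. destruct heq as [heq|heq]; [lra|].
    exfalso. revert heq. apply Rinv_neq_0_compat. nra.
Qed.

(** * Factorization of the Bessel cross products *)

Lemma slit_plane_Cmod_Re_pos (z : C) : slit_plane z -> 0 < Cmod z + Re z.
Proof.
  intros hz. assert (h2 := Cmod2_alt z). assert (h0 := Cmod_ge_0 z).
  apply Rnot_le_lt. intros hle. apply hz.
  assert (h3 : 0 <= Cmod z * Cmod z) by nra.
  assert (h4 : Cmod z ^ 2 <= Re z ^ 2) by nra.
  split; [lra|]. nra.
Qed.

Lemma slit_plane_neq_0 (z : C) : slit_plane z -> z <> RtoC 0.
Proof. intros hz ->. apply hz. split; simpl; lra. Qed.

Lemma Cdiv_2 (z : C) : (z / 2)%C = (Re z / 2, Im z / 2).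
Proof.
  destruct z as [x y]. unfold Cdiv, Cinv, Cmult, Re, Im; simpl. f_equal; field.
Qed.

Lemma slit_plane_half (z : C) : slit_plane z -> slit_plane (z / 2).
Proof.
  intros hz h. apply hz. rewrite Cdiv_2 in h. unfold Re, Im in *; simpl in h. lra.
Qed.

(** The principal logarithm of [t / 2 + i y], as a function of the real number [t]:
    the half is there because the Bessel functions involve powers of [z / 2]. *)
Definition clog_half (y t : R) : C :=
  (ln (Cmod ((t / 2)%R, y)), Carg ((t / 2)%R, y)).

(** With [r = |w|] and [X = Re w], the half-angle formula for the argument
    differentiates well because [(r + X)^2 + (Im w)^2 = 2 r (r + X)]. *)
Lemma curve_derive_clog_half (x y : R) :
  slit_plane ((x / 2)%R, y) ->
  curve_derive (fun t => clog_half y t) x (/ (2 * ((x / 2)%R, y)))%C.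
Proof.
  intros hz. assert (hpos := slit_plane_Cmod_Re_pos _ hz).
  assert (hr := proj1 (Cmod_gt_0 _) (slit_plane_neq_0 _ hz)).
  assert (hr2 := Cmod2_alt ((x / 2)%R, y)).
  unfold Cmod in hpos, hr, hr2. unfold Re, Im in *. simpl in hpos, hr, hr2.
  set (N := x / 2 * (x / 2 * 1) + y * (y * 1)) in *.
  assert (hN : 0 < N).
  { apply Rnot_le_lt. intros h. rewrite sqrt_neg_0 in hr by exact h. lra. }
  assert (hN' : N = x / 2 * (x / 2 * 1) + y * (y * 1)) by reflexivity.
  replace (/ (2 * ((x / 2)%R, y)))%C with (((x / 2) / (2 * N))%R, (- y / (2 * N))%R).
  2:{ rewrite hN' in hN |- *. unfold Cinv, Cmult; simpl. f_equal; field; nra. }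
  split; unfold clog_half, Cmod, Carg, Re, Im; simpl.
  - auto_derive.
    + fold N. split; [exact hN|split; [exact hr|exact I]].
    + change (x * / 2) with (x / 2). fold N.
      set (r := sqrt N) in *. replace N with (r * r) by lra. field. lra.
  - unfold Cmod; simpl. auto_derive.
    + change (x * / 2) with (x / 2). fold N. split; [exact hN|]. split; [|exact I]. lra.
    + change (x * / 2) with (x / 2). fold N.
      set (r := sqrt N) in *. 
      replace N with (r * r) by lra.
      assert (hk : (r + x / 2) * (r + x / 2) + y * y = 2 * r * (r + x / 2)) by nra.
      assert (hk' : 1 + y / (r + x / 2) * (y / (r + x / 2)) = 2 * r / (r + x / 2)).
      { replace (1 + y / (r + x / 2) * (y / (r + x / 2)))
          with (((r + x / 2) * (r + x / 2) + y * y) / ((r + x / 2) * (r + x / 2)))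
          by (field; lra).
        rewrite hk. field. lra. }
      replace (1 + y * / (r + x / 2) * (y * / (r + x / 2) * 1)) with (2 * r / (r + x / 2))
        by (rewrite <- hk'; unfold Rdiv; ring).
      field. split; lra.
Qed.

Definition Cexp (w : C) : C := (exp (Re w) * cos (Im w), exp (Re w) * sin (Im w)).

Lemma is_derive_exp_trig (a b : R -> R) (t da db : R) :
  is_derive a t da -> is_derive b t db ->
  is_derive (fun s => exp (a s) * cos (b s)) t
    (da * (exp (a t) * cos (b t)) - db * (exp (a t) * sin (b t))) /\
  is_derive (fun s => exp (a s) * sin (b s)) t
    (da * (exp (a t) * sin (b t)) + db * (exp (a t) * cos (b t))).
Proof.
  intros ha hb.
  assert (ea : Derive (fun s => a s) t = da) by exact (is_derive_unique _ _ _ ha).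
  assert (eb : Derive (fun s => b s) t = db) by exact (is_derive_unique _ _ _ hb).
  split; auto_derive; try (repeat split; eexists; eassumption);
    rewrite ea, eb; ring.
Qed.

Lemma curve_derive_Cexp (g : R -> C) (t : R) (l : C) :
  curve_derive g t l -> curve_derive (fun s => Cexp (g s)) t (l * Cexp (g t))%C.
Proof.
  intros [g1 g2]. destruct (is_derive_exp_trig _ _ _ _ _ g1 g2) as [h1 h2].
  split; [exact h1|exact h2].
Qed.

Lemma Cexp_neq_0 (w : C) : Cexp w <> RtoC 0.
Proof.
  intros h. unfold Cexp, RtoC in h. injection h as h1 h2.
  assert (he := exp_pos (Re w)). assert (hs := sin2_cos2 (Im w)). unfold Rsqr in hs.
  apply Rmult_integral in h1. apply Rmult_integral in h2.
  destruct h1 as [h1|h1]; [lra|]. destruct h2 as [h2|h2]; [lra|].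
  rewrite h1, h2 in hs. lra.
Qed.

Lemma CRpower_Cexp (z : C) (mu : R) :
  CRpower z mu = Cexp (RtoC mu * (ln (Cmod z), Carg z))%C.
Proof.
  unfold CRpower, Cexp, Rpower, Cmult, Re, Im; simpl.
  rewrite !Rmult_0_l, !Rminus_0_r, !Rplus_0_r. reflexivity.
Qed.

(** [sg = 1] gives [I] and [sg = -1] gives [J]. *)
Definition bessel_like (nu sg : R) (z : C) : C :=
  (CRpower (z / 2) nu * clifford nu (RtoC sg * ((z / 2) * (z / 2))))%C.

Lemma BesselI_bessel_like (nu : R) (z : C) : BesselI nu z = bessel_like nu 1 z.
Proof.
  unfold BesselI, bessel_like, clifford, entire_sum. f_equal. apply CSeries_ext. intros n.
  unfold bessel_coef. rewrite Cpow_mult_r, Cpow_mult_l, Cpow_1_l.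
  replace (1 / (INR (fact n) * Gamma (nu + INR n + 1)))
    with (/ (INR (fact n) * Gamma (nu + INR n + 1))) by (unfold Rdiv; ring).
  simpl. rewrite Cmult_1_l, Cmult_1_r. reflexivity.
Qed.

Lemma BesselJ_bessel_like (nu : R) (z : C) : BesselJ nu z = bessel_like nu (-1) z.
Proof.
  unfold BesselJ, bessel_like, clifford, entire_sum. f_equal. apply CSeries_ext. intros n.
  unfold bessel_coef. rewrite Cpow_mult_r, Cpow_mult_l.
  unfold Rdiv. rewrite RtoC_mult, RtoC_pow. simpl. rewrite Cmult_1_r. ring.
Qed.

Lemma C_derive_bessel_like (nu sg : R) (z : C) :
  -1 < nu -> slit_plane z ->
  C_derive (bessel_like nu sg) z =
  (RtoC nu / z * bessel_like nu sg z
   + CRpower (z / 2) nu * (clifford_d1 nu (RtoC sg * ((z / 2) * (z / 2))) * (RtoC sg * (z / 2))))%C.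
Proof.
  intros hnu hz. apply C_derive_of_horizontal.
  assert (hz0 := slit_plane_neq_0 z hz).
  assert (hhalf := slit_plane_half z hz).
  destruct z as [x y]. simpl fst. simpl snd.
  assert (ehalf : forall t, ((t, y) / 2)%C = ((t / 2)%R, (y / 2)%R))
    by (intros t; rewrite Cdiv_2; reflexivity).
  assert (hpow : curve_derive (fun t => CRpower ((t, y) / 2) nu) x
                   (RtoC nu / (x, y) * CRpower ((x, y) / 2) nu)%C).
  { rewrite ehalf in hhalf.
    assert (hlog := curve_derive_scal (RtoC nu) _ _ _ (curve_derive_clog_half x (y / 2) hhalf)).
    apply curve_derive_Cexp in hlog.
    assert (efun : forall t, CRpower ((t, y) / 2) nu = Cexp (RtoC nu * clog_half (y / 2) t)).
    { intros t. rewrite CRpower_Cexp, ehalf. reflexivity. }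
    rewrite efun.
    replace (RtoC nu / (x, y))%C with (RtoC nu * / (2 * ((x / 2)%R, (y / 2)%R)))%C.
    2:{ rewrite <- ehalf. field. exact hz0. }
    destruct hlog as [k1 k2]. split.
    - apply is_derive_ext with (2 := k1). intros t. rewrite efun. reflexivity.
    - apply is_derive_ext with (2 := k2). intros t. rewrite efun. reflexivity. }
  assert (hhf : curve_derive (fun t => ((t, y) / 2)%C) x (/ 2)%C).
  { replace (/ 2)%C with ((/ 2)%R, 0) by (unfold Cinv; simpl; f_equal; field).
    split.
    - apply is_derive_ext with (fun t => t / 2).
      + intros t. rewrite ehalf. reflexivity.
      + change (is_derive (fun t => t / 2) x (/ 2)). auto_derive; [exact I|field].
    - apply is_derive_ext with (fun t => y / 2).
      + intros t. rewrite ehalf. reflexivity.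
      + change (is_derive (fun t : R => y / 2) x 0).
        apply (is_derive_const (V := R_NormedModule)). }
  assert (harg := curve_derive_scal (RtoC sg) _ _ _ (curve_derive_mult _ _ _ _ _ hhf hhf)).
  assert (hser := entire_curve_derive _ _ _ _ (bessel_coef_entire nu hnu) harg).
  eapply curve_derive_eq.
  - exact (curve_derive_mult _ _ _ _ _ hpow hser).
  - cbv beta. unfold bessel_like, clifford_d1, clifford. field. exact hz0.
Qed.

(** The terms [nu / z] of the two logarithmic derivatives cancel. *)
Lemma PhiBessel_factor (nu : R) (z : C) :
  -1 < nu -> slit_plane z ->
  PhiBessel nu z
  = (CRpower (z / 2) nu * CRpower (z / 2) nu * (z / 2) * clifford_cross nu ((z / 2) * (z / 2)))%C.
Proof.
  intros hnu hz. unfold PhiBessel.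
  replace (C_derive (BesselI nu) z) with (C_derive (bessel_like nu 1) z).
  2:{ unfold C_derive, C_lim. f_equal; f_equal; apply Lim_ext; intros t;
      rewrite !BesselI_bessel_like; reflexivity. }
  replace (C_derive (BesselJ nu) z) with (C_derive (bessel_like nu (-1)) z).
  2:{ unfold C_derive, C_lim. f_equal; f_equal; apply Lim_ext; intros t;
      rewrite !BesselJ_bessel_like; reflexivity. }
  rewrite BesselI_bessel_like, BesselJ_bessel_like.
  rewrite !C_derive_bessel_like by assumption.
  unfold clifford_cross, bessel_like.
  assert (hz0 := slit_plane_neq_0 z hz).
  set (w := ((z / 2) * (z / 2))%C). set (h := (z / 2)%C).
  replace (RtoC 1 * w)%C with w by ring.
  replace (RtoC (-1) * w)%C with (- w)%C by (unfold w; ring).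
  field. exact hz0.
Qed.

Lemma PiBessel_factor (nu : R) (z : C) :
  PiBessel nu z
  = (CRpower (z / 2) nu * CRpower (z / 2) nu *
     (clifford nu (- ((z / 2) * (z / 2))) * clifford nu ((z / 2) * (z / 2))))%C.
Proof.
  unfold PiBessel. rewrite BesselI_bessel_like, BesselJ_bessel_like. unfold bessel_like.
  set (w := ((z / 2) * (z / 2))%C).
  replace (RtoC 1 * w)%C with w by ring.
  replace (RtoC (-1) * w)%C with (- w)%C by (unfold w; ring).
  ring.
Qed.

Lemma CRpower_neq_0 (z : C) (mu : R) : CRpower z mu <> RtoC 0.
Proof. rewrite CRpower_Cexp. apply Cexp_neq_0. Qed.

Lemma slit_plane_pos (x : R) : 0 < x -> slit_plane (RtoC x).
Proof. intros hx [h _]. simpl in h. lra. Qed.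

(** * Transfer of zeros from the square to the variable *)

(** If [zeta = z^2 / 4] is real, then [z] is real or purely imaginary; in the second
    case evenness of [F] replaces [zeta] by [- zeta], which turns the zero into a real
    one. *)
Lemma quarter_turns_of_even (f F : C -> C) :
  (forall z, slit_plane z -> f z = RtoC 0 <-> F ((z / 2) * (z / 2))%C = RtoC 0) ->
  (forall w, F (- w)%C = RtoC 0 <-> F w = RtoC 0) ->
  (forall w, F w = RtoC 0 -> Im w = 0) ->
  zeros_real_up_to_quarter_turns f.
Proof.
  intros hf heven hreal z hz hfz.
  assert (hF := proj1 (hf z hz) hfz). assert (hi := hreal _ hF).
  rewrite Cdiv_2 in hF, hi. destruct z as [x y]. unfold Re, Im in *. simpl in *.
  assert (hxy : x * y = 0) by lra.
  assert (hpos : forall r, 0 < r ->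
     F (RtoC (r * r / 4)) = RtoC 0 -> positive_zero f r).
  { intros r hr hFr. split; [exact hr|]. apply hf; [apply slit_plane_pos; exact hr|].
    rewrite Cdiv_2. replace (_ * _)%C with (RtoC (r * r / 4)); [exact hFr|].
    unfold RtoC, Cmult, Re, Im; simpl. f_equal; field. }
  assert (hopp : forall w, F w = RtoC 0 -> F (- w)%C = RtoC 0) by (intros w; apply heven).
  apply Rmult_integral in hxy. destruct hxy as [-> | ->].
  - assert (hFy : F (RtoC (y * y / 4)) = RtoC 0).
    { apply hopp in hF. rewrite <- hF. f_equal. unfold RtoC, Copp, Cmult; simpl. f_equal; field. }
    destruct (Rtotal_order y 0) as [hy|[hy|hy]].
    + exists 3%nat, (- y). split.
      * apply hpos; [lra|]. replace (- y * - y) with (y * y) by ring. exact hFy.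
      * unfold Ci, RtoC, Cpow, Cmult; simpl. f_equal; ring.
    + exfalso. apply hz. rewrite hy. split; simpl; lra.
    + exists 1%nat, y. split; [apply hpos; assumption|].
      unfold Ci, RtoC, Cpow, Cmult; simpl. f_equal; ring.
  - exists 0%nat, x. split.
    + apply hpos.
      * apply Rnot_le_lt. intros hx. apply hz. split; simpl; lra.
      * rewrite <- hF. f_equal. unfold RtoC, Cmult; simpl. f_equal; field.
    + unfold RtoC, Cpow, Cmult; simpl. f_equal; ring.
Qed.

Lemma infinitely_many_of_unbounded (P : R -> Prop) :
  (forall M, exists x, M < x /\ P x) -> infinitely_many P.
Proof.
  intros hP l.
  assert (hM : exists M, forall x, In x l -> x <= M).
  { induction l as [|a l [M hM]].
    - exists 0. intros x [].
    - exists (Rmax a M). intros x [<-|hx]; [apply Rmax_l|].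
      apply Rle_trans with (1 := hM x hx). apply Rmax_r. }
  destruct hM as [M hM]. destruct (hP M) as [x [hx hPx]].
  exists x. split; [exact hPx|]. intros hin. generalize (hM x hin). lra.
Qed.

Lemma positive_zeros_of_unbounded (f F : C -> C) :
  (forall z, slit_plane z -> f z = RtoC 0 <-> F ((z / 2) * (z / 2))%C = RtoC 0) ->
  (forall M, exists s, M < s /\ F (RtoC s) = RtoC 0) ->
  infinitely_many (positive_zero f).
Proof.
  intros hf hF. apply infinitely_many_of_unbounded. intros M.
  destruct (hF (Rmax M 0 * Rmax M 0 / 4)) as [s [hs hs0]].
  assert (hM := Rmax_l M 0). assert (h0 := Rmax_r M 0).
  assert (hs' : 0 < s) by nra.
  assert (hsq := sqrt_sqrt s (Rlt_le _ _ hs')). assert (hq := sqrt_lt_R0 s hs').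
  exists (2 * sqrt s). split.
  - nra.
  - split; [lra|]. apply hf; [apply slit_plane_pos; lra|].
    rewrite Cdiv_2. rewrite <- hs0. f_equal. unfold RtoC, Cmult, Re, Im; simpl.
    f_equal; [|field]. rewrite <- hsq at 3. field.
Qed.

Lemma PiBessel_zero_iff (nu : R) (z : C) :
  PiBessel nu z = RtoC 0 <->
  (clifford nu (- ((z / 2) * (z / 2))) * clifford nu ((z / 2) * (z / 2)))%C = RtoC 0.
Proof.
  rewrite PiBessel_factor. split; intros h.
  - apply Classical_Prop.NNPP. intros hne.
    assert (hp := CRpower_neq_0 (z / 2) nu).
    exact (Cmult_neq_0 _ _ (Cmult_neq_0 _ _ hp hp) hne h).
  - rewrite h. ring.
Qed.

Lemma PhiBessel_zero_iff (nu : R) (z : C) :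
  -1 < nu -> slit_plane z ->
  PhiBessel nu z = RtoC 0 <-> clifford_cross nu ((z / 2) * (z / 2)) = RtoC 0.
Proof.
  intros hnu hz. rewrite PhiBessel_factor by assumption. split; intros h.
  - apply Classical_Prop.NNPP. intros hne.
    assert (hp := CRpower_neq_0 (z / 2) nu).
    assert (hz2 := slit_plane_neq_0 _ (slit_plane_half z hz)).
    exact (Cmult_neq_0 _ _ (Cmult_neq_0 _ _ (Cmult_neq_0 _ _ hp hp) hz2) hne h).
  - rewrite h. ring.
Qed.

Theorem theorem1 (nu : R) (hnu : (-1 < nu)%R) :
  (infinitely_many (positive_zero (PhiBessel nu)) /\
   zeros_real_up_to_quarter_turns (PhiBessel nu)) /\
  (infinitely_many (positive_zero (PiBessel nu)) /\
   zeros_real_up_to_quarter_turns (PiBessel nu)).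
Proof.
  assert (h0 := bessel_coef_entire nu hnu). assert (h1 := entire_derive _ h0).
  set (c := bessel_coef nu) in *.
  set (F0 := PSeries c). set (F1 := PSeries (PS_derive c)).
  set (F2 := PSeries (PS_derive (PS_derive c))).
  assert (e0 : forall s, clifford nu (RtoC s) = RtoC (F0 s)) by (intros s; apply entire_sum_RtoC).
  assert (e1 : forall s, clifford_d1 nu (RtoC s) = RtoC (F1 s)) by (intros s; apply entire_sum_RtoC).
  assert (e2 : forall s, clifford_d2 nu (RtoC s) = RtoC (F2 s)) by (intros s; apply entire_sum_RtoC).
  assert (d0 : forall s, is_derive F0 s (F1 s))
    by (intros s; apply is_derive_PSeries; rewrite h0; exact I).
  assert (d1 : forall s, is_derive F1 s (F2 s))
    by (intros s; apply is_derive_PSeries; rewrite h1; exact I).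
  assert (ode : forall s, s * F2 s + (nu + 1) * F1 s = F0 s).
  { intros s. apply RtoC_inj. rewrite RtoC_plus, !RtoC_mult, <- e0, <- e1, <- e2.
    apply clifford_ode. exact hnu. }
  assert (pos : forall s, 0 < s -> 0 < F0 s).
  { intros s hs.
    assert (hex : ex_series (fun n => c n * s ^ n)).
    { apply ex_series_ext with (fun n => Rabs (c n) * s ^ n).
      - intros n. rewrite Rabs_pos_eq; [reflexivity|]. left; apply bessel_coef_pos; exact hnu.
      - apply entire_majorant; [exact h0|lra]. }
    unfold F0, PSeries. rewrite Series_incr_1 by exact hex. simpl.
    assert (hc := bessel_coef_pos nu 0 hnu).
    assert (0 <= Series (fun k => c (S k) * (s * s ^ k))).
    { rewrite <- (Rmult_0_l (Series (fun _ => 0))). rewrite <- Series_scal_l.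
      apply Series_le.
      - intros n. split; [lra|]. rewrite Rmult_0_l.
        apply Rmult_le_pos; [left; apply bessel_coef_pos; exact hnu|].
        apply (pow_le s (S n)). lra.
      - apply (ex_series_incr_1 (fun n => c n * s ^ n)). exact hex. }
    unfold c at 1. lra. }
  assert (opp_real : forall s, (- RtoC s)%C = RtoC (- s)) by (intros s; rewrite RtoC_opp; ring).
  split; split.
  - apply positive_zeros_of_unbounded with (clifford_cross nu).
    + intros z hz. apply PhiBessel_zero_iff; assumption.
    + intros M. destruct (cross_product_zeros_unbounded nu F0 F1 F2 M d0 d1 ode pos)
        as [s [hs hs0]].
      exists s. split; [exact hs|]. unfold clifford_cross.
      rewrite opp_real, !e0, !e1, <- !RtoC_mult, <- RtoC_plus, hs0. reflexivity.
  - apply quarter_turns_of_even with (clifford_cross nu).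
    + intros z hz. apply PhiBessel_zero_iff; assumption.
    + intros w. unfold clifford_cross. replace (- - w)%C with w by ring.
      rewrite (Cplus_comm (clifford nu w * _)), (Cmult_comm (clifford_d1 nu w)), (Cmult_comm (clifford nu w)).
      tauto.
    + intros w. apply clifford_cross_zero_real. exact hnu.
  - apply positive_zeros_of_unbounded with (fun w => clifford nu (- w) * clifford nu w)%C.
    + intros z _. apply PiBessel_zero_iff.
    + intros M. destruct (negative_zeros_unbounded nu F0 F1 F2 M d0 d1 ode) as [s [hs hs0]].
      exists s. split; [exact hs|]. rewrite opp_real, e0, hs0. ring.
  - apply quarter_turns_of_even with (fun w => clifford nu (- w) * clifford nu w)%C.
    + intros z _. apply PiBessel_zero_iff.
    + intros w. replace (- - w)%C with w by ring. rewrite Cmult_comm. tauto.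
    + intros w hw.
      destruct (Classical_Prop.classic (clifford nu w = RtoC 0)) as [h|h].
      * exact (clifford_zero_real nu w hnu h).
      * destruct (Classical_Prop.classic (clifford nu (- w) = RtoC 0)) as [h'|h'].
        -- apply (clifford_zero_real nu _ hnu) in h'. unfold Im in *; simpl in h'. lra.
        -- exfalso. exact (Cmult_neq_0 _ _ h' h hw).
Qed.
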